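(* Let $S(W,V)$ be a quasi-Lie scheme and let $F:\mathcal{V}\rightarrow C^\infty(\mathbb{R})$ be a mapping of the form $[F(X)](t)=\varphi_F({\bf t}^2_tX)$ for all $t\in\mathbb{R}$, $X\in\mathcal{V}$, with $\varphi_F:T^2V\to\mathbb{R}$. Then $F$ is a quasi-Lie invariant of order two for $S(W,V)$ if and only if $\varphi_F$ is a common first-integral of: the Lie algebras of fundamental vector fields $V_{\mathcal{J}^2}$ and $V_{\mathcal{T}^2}$ of the actions $\mathcal{J}^2$ and $\mathcal{T}^2$; the vector fields related to the flows $\mathcal{T}_1^L$ with $L\in W$; and the fundamental vector fields of the action $\mathcal{T}_2$.
   Context: All objects are smooth and global. A quasi-Lie scheme $S(W,V)$ consists of finite-dimensional real vector spaces $W,V$ of vector fields on $\mathbb{R}^n$ with $[W,W]\subset W\subset V$ and $[W,V]\subset V$. $\mathcal{V}$ (resp. $\mathcal{W}$) is the family of $t$-dependent vector fields $X=\{X_t\}_{t\in\mathbb{R}}$ with $X_t\in V$ (resp. $X_t\in W$) for all $t$. $\mathcal{G}_W$ is the group of generalised flows $g=\{g_t\}$ of elements of $\mathcal{W}$, i.e. of curves in the connected Lie group $G$ with Lie algebra $\simeq W$ acting on $\mathbb{R}^n$ with $W$ as Lie algebra of fundamental vector fields; it acts on $\mathcal{V}$ by $(g_\bigstar X)_t=\frac{\partial g_t}{\partial t}\circ g_t^{-1}+g_{t*}X_t$. A quasi-Lie invariant is a map $F:\mathcal{V}\to C^\infty(\mathbb{R})$ with $F(g_\bigstar X)=F(X)$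 for all $g\in\mathcal{G}_W$, $X\in\mathcal{V}$; it is of order two if there is $\varphi_F:T^2V\to\mathbb{R}$ with $[F(X)](t)=\varphi_F({\bf t}^2_tX)$ for all $t,X$. Here ${\bf t}^2_{t_0}X$ is the second-order tangent vector at $t_0$ of the curve $t\mapsto X_t$ in $V$; $T^2V\simeq V^3$ via ${\bf t}^2_{t_0}X=\left(X_{t_0},\frac{dX_{t_0}}{d\bar t},\frac{d^2X_{t_0}}{d\bar t^2}\right)$, where $\bar t=\bar t(t)$ is a chosen parameter (for instance $\bar t=t$, in which case $\frac{dt}{d\bar t}=1$, $\frac{d^2t}{d\bar t^2}=0$ below), with derivatives evaluated at $t_0$. A first-integral of a vector field is a function annihilated by it. The actions on $T^2V$ are: (i) $\mathcal{J}^2:G\times T^2V\to T^2V$, $(g;(X_0,X_1,X_2))\mapsto(g_*X_0,g_*X_1,g_*X_2)$. (ii) $\mathcal{T}^2:T^2_1W\times T^2V\to T^2V$, $({\bf t}^2_{t_0}Y;{\bf t}^2_{t_0}X)\mapsto{\bf t}^2_{t_0}(X+Y)$, where $T^2_1W$ is the Abelian group of those ${\bf t}^2_{t_0}Y\in T^2W$ with ${\bf t}^1_{t_0}Y=0$. (iii) For $L\in W$, the flow $\mathcal{T}_1^L:\mathbb{R}\times T^2V\to T^2V$, $$\mathcal{T}_1^L(s;(X,Y,Z))=(X,Y,Z)+\left(sL,\,-s\tfrac{dt}{d\bar t}[L,X],\,s^2\left(\tfrac{dt}{d\bar t}\right)^2[L,[L,X]]-2s\tfrac{dt}{d\bar t}[L,Y]-s\tfrac{d^2t}{d\bar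 t^2}[L,X]\right).$$ (iv) $\mathcal{T}_2:T^2_0W\times T^2V\to T^2V$, where $T^2_0W=\{{\bf t}^2_{t_0}Y\in T^2W: Y_{t_0}=0\}$ with its Abelian group structure, $$\mathcal{T}_2\left(\left(0,\tfrac{dY_{t_0}}{d\bar t},\tfrac{d^2Y_{t_0}}{d\bar t^2}\right);\left(X_{t_0},\tfrac{dX_{t_0}}{d\bar t},\tfrac{d^2X_{t_0}}{d\bar t^2}\right)\right)=\left(X_{t_0},\,\tfrac{dY_{t_0}}{d\bar t}+\tfrac{dX_{t_0}}{d\bar t},\,-\tfrac{dt}{d\bar t}\left[\tfrac{dY_{t_0}}{d\bar t},X_{t_0}\right]+\tfrac{d^2X_{t_0}}{d\bar t^2}+\tfrac{d^2Y_{t_0}}{d\bar t^2}\right).$$ *)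

(* Defs.v *)
From mathcomp Require Import all_boot all_order all_algebra.
From mathcomp Require Import all_classical all_reals all_analysis.

Set Implicit Arguments.
Unset Strict Implicit.
Unset Printing Implicit Defensive.

Import Order.TTheory GRing.Theory Num.Theory.
Import numFieldNormedType.Exports.

Local Open Scope classical_set_scope.
Local Open Scope ring_scope.

(* C^infinity: every iterated directional derivative exists and is Frechet
   differentiable (hence continuous) everywhere. *)
Definition smooth (R : realType) (U V : normedModType R) (f : U -> V) : Prop :=
  forall (vs : seq U) (x : U),
    differentiable (foldr (fun v (h : U -> V) => fun y => 'D_v h y) f vs) x.

Notation vfield R n := ('rV[R]_n -> 'rV[R]_n).

(* [X, Y] = DY . X - DX . Y, the convention for which the push-forwards of Y
   by the flow of X have derivative - [X, Y] at time 0. *)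
Definition bracket (R : realType) (n : nat) (X Y : vfield R n) : vfield R n :=
  fun x => 'D_(X x) Y x - 'D_(Y x) X x.

Definition fd_subspace (R : realType) (n : nat) (V : set (vfield R n)) : Prop :=
  exists (r : nat) (b : 'I_r -> vfield R n),
    V = [set X | exists c : 'I_r -> R, X = \sum_(i < r) c i *: b i].

Record diffeo (R : realType) (n : nat) := Diffeo {
  dmap :> 'rV[R]_n -> 'rV[R]_n;
  dinv : 'rV[R]_n -> 'rV[R]_n;
  dmapK : cancel dmap dinv;
  dinvK : cancel dinv dmap;
  dmap_smooth : smooth dmap;
  dinv_smooth : smooth dinv }.

Definition pushforward (R : realType) (n : nat) (g : diffeo R n)
    (X : vfield R n) : vfield R n :=
  fun x => 'D_(X (dinv g x)) g (dinv g x).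

(* For V finite-dimensional, joint smoothness in (t, x) is the same as
   smoothness of the curve t |-> X_t in V. *)
Definition tdep (R : realType) (n : nat) (V : set (vfield R n)) :
    set (R -> vfield R n) :=
  [set X | (forall t, V (X t)) /\
           smooth (fun p : R * 'rV[R]_n => X p.1 p.2)].

(* g is the generalised flow of the t-dependent vector field Y. For a constant
   Y = L it is the one-parameter group of diffeomorphisms exp(tL). *)
Definition is_gflow (R : realType) (n : nat) (Y : R -> vfield R n)
    (g : R -> diffeo R n) : Prop :=
  [/\ smooth (fun p : R * 'rV[R]_n => g p.1 p.2),
      smooth (fun p : R * 'rV[R]_n => dinv (g p.1) p.2),
      (forall x, g 0 x = x) &
      forall t x, derive1 (fun s => g s x) t = Y t (g t x)].

(* The last field says that the elements of W are complete; by Palais' theorem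
   this is the integrability of W to an action on R^n of the connected Lie
   group G, whose image in Diff(R^n) is generated by the flows of W. *)
Record quasi_lie_scheme (R : realType) (n : nat) (W V : set (vfield R n)) :
    Prop := QuasiLieScheme {
  qls_W_fd : fd_subspace W;
  qls_V_fd : fd_subspace V;
  qls_smooth : forall X, V X -> smooth X;
  qls_WV : W `<=` V;
  qls_brWW : forall X Y, W X -> W Y -> W (bracket X Y);
  qls_brWV : forall X Y, W X -> V Y -> V (bracket X Y);
  qls_complete : forall L, W L -> exists g, is_gflow (fun=> L) g }.

Definition gflows (R : realType) (n : nat) (W : set (vfield R n)) :
    set (R -> diffeo R n) :=
  [set g | exists2 Y, tdep W Y & is_gflow Y g].

Definition gflow_act (R : realType) (n : nat) (g : R -> diffeo R n)
    (X : R -> vfield R n) : R -> vfield R n :=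
  fun t x => derive1 (fun s => g s (dinv (g t) x)) t + pushforward (g t) (X t) x.

(* Admissible parameters tbar = tbar(t). *)
Definition is_parameter (R : realType) (tbar : R -> R) : Prop :=
  smooth tbar /\ forall t, derive1 tbar t != 0.

(* d/dtbar = (dtbar/dt)^-1 d/dt, applied to a function of t. *)
Definition dpar (R : realType) (U : normedModType R) (tbar : R -> R)
    (c : R -> U) : R -> U :=
  fun t => (derive1 tbar t)^-1 *: derive1 c t.

Definition dpar_vf (R : realType) (n : nat) (tbar : R -> R)
    (X : R -> vfield R n) : R -> vfield R n :=
  fun t x => dpar tbar (fun s => X s x) t.

Definition dt_dtbar (R : realType) (tbar : R -> R) : R -> R :=
  dpar tbar (fun t : R => t).

Definition d2t_dtbar2 (R : realType) (tbar : R -> R) : R -> R :=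
  dpar tbar (dt_dtbar tbar).

(* T^2 V and T^2 W are the subsets V^3 and W^3 of the space of triples of
   vector fields. *)
Notation triple R n := (vfield R n * vfield R n * vfield R n)%type.

Definition T2 (R : realType) (n : nat) (V : set (vfield R n)) :
    set (triple R n) :=
  [set p | [/\ V p.1.1, V p.1.2 & V p.2]].

Definition jet2 (R : realType) (n : nat) (tbar : R -> R)
    (X : R -> vfield R n) (t0 : R) : triple R n :=
  (X t0, dpar_vf tbar X t0, dpar_vf tbar (dpar_vf tbar X) t0).

(* Smoothness of phi on the finite-dimensional space T^2 V: smoothness in the
   linear coordinates given by any finite family of elements of V (for instance
   a basis). The values of phi outside T^2 V play no role. *)
Definition smooth_on_T2 (R : realType) (n : nat) (V : set (vfield R n))
    (phi : triple R n -> R) : Prop :=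
  forall (r : nat) (b : 'I_r -> vfield R n), (forall i, V (b i)) ->
    smooth (fun c : 'rV[R]_r * 'rV[R]_r * 'rV[R]_r =>
      phi (\sum_(i < r) c.1.1 0 i *: b i,
           \sum_(i < r) c.1.2 0 i *: b i,
           \sum_(i < r) c.2 0 i *: b i)).

Definition quasi_lie_invariant (R : realType) (n : nat)
    (W V : set (vfield R n)) (F : (R -> vfield R n) -> R -> R) : Prop :=
  (forall X, tdep V X -> smooth (F X)) /\
  (forall g X, gflows W g -> tdep V X -> F (gflow_act g X) = F X).

Definition order_two (R : realType) (n : nat) (V : set (vfield R n))
    (tbar : R -> R) (F : (R -> vfield R n) -> R -> R) : Prop :=
  exists2 phi : triple R n -> R, smooth_on_T2 V phi &
    forall X t, tdep V X -> F X t = phi (jet2 tbar X t).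

Definition actJ2 (R : realType) (n : nat) (g : diffeo R n) (p : triple R n) :
    triple R n :=
  (pushforward g p.1.1, pushforward g p.1.2, pushforward g p.2).

Definition T2_1 (R : realType) (n : nat) (W : set (vfield R n)) :
    set (triple R n) :=
  [set q | [/\ T2 W q, q.1.1 = 0 & q.1.2 = 0]].

Definition actT2 (R : realType) (n : nat) (q p : triple R n) : triple R n :=
  p + q.

(* Here a = dt/dtbar and b = d^2t/dtbar^2 at the base time. *)
Definition flowT1 (R : realType) (n : nat) (a b : R) (L : vfield R n) (s : R)
    (p : triple R n) : triple R n :=
  let: (X, Y, Z) := p in
  (X, Y, Z) +
  (s *: L,
   - ((s * a) *: bracket L X),
   (s ^+ 2 * a ^+ 2) *: bracket L (bracket L X)
     - (2 * s * a) *: bracket L Y - (s * b) *: bracket L X).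

Definition T2_0 (R : realType) (n : nat) (W : set (vfield R n)) :
    set (triple R n) :=
  [set q | T2 W q /\ q.1.1 = 0].

Definition actT2_0 (R : realType) (n : nat) (a : R) (q p : triple R n) :
    triple R n :=
  (p.1.1, q.1.2 + p.1.2, - (a *: bracket q.1.2 p.1.1) + p.2 + q.2).

(* Value at p of the vector field d/ds|_(s = 0) Phi_s(p) on T^2 V. A curve in
   the finite-dimensional space V is differentiated pointwise on R^n. *)
Definition generator (R : realType) (n : nat)
    (Phi : R -> triple R n -> triple R n) : triple R n -> triple R n :=
  fun p => ((fun x => derive1 (fun s => (Phi s p).1.1 x) 0),
            (fun x => derive1 (fun s => (Phi s p).1.2 x) 0),
            (fun x => derive1 (fun s => (Phi s p).2 x) 0)).

(* Fundamental vector fields are generators of the one-parameter subgroups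
   s |-> exp(s xi); the convention exp(- s xi) gives the same sets. *)
Definition fundJ2 (R : realType) (n : nat) (W : set (vfield R n)) :
    set (triple R n -> triple R n) :=
  [set A | exists L g, [/\ W L, is_gflow (fun=> L) g &
                           A = generator (fun s => actJ2 (g s))]].

Definition fundT2 (R : realType) (n : nat) (W : set (vfield R n)) :
    set (triple R n -> triple R n) :=
  [set A | exists2 q, T2_1 W q & A = generator (fun s => actT2 (s *: q))].

Definition fieldT1 (R : realType) (n : nat) (W : set (vfield R n)) (a b : R) :
    set (triple R n -> triple R n) :=
  [set A | exists2 L, W L & A = generator (flowT1 a b L)].

Definition fundT2_0 (R : realType) (n : nat) (W : set (vfield R n)) (a : R) :
    set (triple R n -> triple R n) :=
  [set A | exists2 q, T2_0 W q & A = generator (fun s => actT2_0 a (s *: q))].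

(* A annihilates phi on T^2 V, as a derivation. *)
Definition first_integral (R : realType) (n : nat) (V : set (vfield R n))
    (A : triple R n -> triple R n) (phi : triple R n -> R) : Prop :=
  forall p, T2 V p -> derive1 (fun s : R => phi (p + s *: A p)) 0 = 0.

(* Main.v *)
(* With Y generating g, the transformed curve Y_t + g_{t*} X_t is differentiated
   twice by d/dt g_{t*} X_t = g_{t*} X'_t - [Y_t, g_{t*} X_t]; its second-order
   jet at t is the jet of X at t moved by J^2(g_t), then by the time-one flow
   T_1^{Y_t}, then by T_2 with parameters (0, Y', Y'' + a [Y', Y]). If phi is a
   first integral it is constant along each of the three motions (for J^2, along
   s |-> g_{s*} p, whose velocity is the fundamental field of Y_s), hence F is
   invariant. Conversely, the generalised flows exp(f(t) L), L in W and f(0) = 0,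
   realise each motion separately by a suitable choice of the jet of f at t0, so
   phi is constant along the four kinds of flows.

   The facts this rests on are that mixed partial derivatives commute, and that
   g_{t*} V is contained in V, which follows from uniqueness for linear
   differential equations. *)
Require Import Defs.
From mathcomp Require Import all_boot all_order all_algebra.
From mathcomp Require Import all_classical all_reals all_analysis ring lra.
Import Order.TTheory GRing.Theory Num.Theory.
Import numFieldNormedType.Exports.
Local Open Scope classical_set_scope.
Local Open Scope ring_scope.

Set Implicit Arguments.
Unset Strict Implicit.
Unset Printing Implicit Defensive.

(* all_analysis has other constants with these names. *)
Local Notation dinv := Defs.dinv.
Local Notation pushforward := Defs.pushforward.

(** * Smooth maps *)

(** Smoothness of [phi] is smoothness in linear coordinates of V, while every derivative in time is
    taken pointwise on R^n. The two are reconciled by a basis of V dual to finitely many point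
    evaluations: coordinates of a field are then entries of its values, and membership in V becomes
    a family of linear equations on values, which pass to time derivatives. Invariance of V has to
    be shown without solving any equation. The pull-backs of a basis exist already, so uniqueness
    for the linear system that they satisfy is enough. In the converse two restrictions shape the
    choices. A generalised flow is the identity at time 0, so a group element other than the
    identity can only be prescribed at a base time different from 0; since J^2 does not involve the
    base time, time 1 serves. And exp(f(t) L) only produces multiples of a single L, while a
    parameter of T_2 has two unrelated entries, so that motion is decomposed into two. *)

Lemma derive_comp (R : realType) (U V W : normedModType R) (g : U -> V)
    (f : V -> W) (x v : U) : differentiable g x -> differentiable f (g x) ->
  'D_v (fun y => f (g y)) x = 'D_('D_v g x) f (g x).
Proof.
move=> dg df; have dfg : differentiable (f \o g) x by exact: differentiable_comp.
by rewrite deriveE// [LHS](congr1 (fun h => h v) (diff_comp dg df)) /= -!deriveE.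
Qed.

Lemma deriveDir (R : realType) (U V : normedModType R) (f : U -> V) (x v w : U) :
  differentiable f x -> 'D_(v + w) f x = 'D_v f x + 'D_w f x.
Proof. by move=> df; rewrite !deriveE// linearD. Qed.

Lemma deriveDirZ (R : realType) (U V : normedModType R) (f : U -> V) (x v : U) k :
  differentiable f x -> 'D_(k *: v) f x = k *: 'D_v f x.
Proof. by move=> df; rewrite !deriveE// linearZ. Qed.

Lemma derive_pair (R : realType) (U V W : normedModType R) (f : U -> V)
    (g : U -> W) (x v : U) : differentiable f x -> differentiable g x ->
  'D_v (fun y => (f y, g y)) x = ('D_v f x, 'D_v g x).
Proof.
move=> df dg; rewrite deriveE; last exact: differentiable_pair.
by rewrite [LHS](congr1 (fun h => h v) (diff_pair df dg)) /= -!deriveE.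
Qed.

Lemma smooth_differentiable (R : realType) (U V : normedModType R) (f : U -> V) x :
  smooth f -> differentiable f x.
Proof. by move=> /(_ [::] x). Qed.

Lemma smooth_derive (R : realType) (U V : normedModType R) (f : U -> V) v :
  smooth f -> smooth (fun y => 'D_v f y).
Proof.
move=> sf vs x; have := sf (vs ++ [:: v]) x.
by rewrite foldr_cat.
Qed.

(** Induction on the number of derivatives breaks for composites, whose derivatives are sums of
    products of other composites. Since [smooth] quantifies over all lists of directions, it is
    enough to name a class that differentiation does not leave. *)
Lemma smooth_coind (R : realType) (U V : normedModType R) (C : set (U -> V)) :
  (forall f x, C f -> differentiable f x) ->
  (forall f v, C f -> C (fun y => 'D_v f y)) ->
  forall f, C f -> smooth f.
Proof.
move=> Cd CD f Cf vs x; apply: Cd.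
by elim: vs => //= v vs IH; exact: CD.
Qed.

Lemma smooth_cst (R : realType) (U V : normedModType R) (a : V) :
  smooth (fun _ : U => a).
Proof.
apply: (@smooth_coind _ _ _ [set f | exists a, f = cst a]); last by exists a.
- by move=> _ x [b ->]; exact: differentiable_cst.
- by move=> _ v [b ->]; exists 0; apply/funext => y; rewrite derive_cst.
Qed.

Lemma smooth_linear (R : realType) (U V : normedModType R) (f : {linear U -> V}) :
  continuous f -> smooth f.
Proof.
move=> cf; have df x : differentiable f x by exact: linear_differentiable.
(* One differentiation turns [f] into a constant, so the class is [f] together with the maps that
   are already smooth. *)
apply: (@smooth_coind _ _ _ [set h : U -> V | h = (f : U -> V) \/ smooth h]);
  last by left.
- by move=> h x [->|/smooth_differentiable].
- move=> h v [->|sh]; right; last exact: smooth_derive.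
  rewrite (_ : (fun y => _) = fun=> f v); first exact: smooth_cst.
  by apply/funext => y; rewrite deriveE// diff_lin.
Qed.

Lemma smooth_id (R : realType) (U : normedModType R) : smooth (fun x : U => x).
Proof. by apply: (@smooth_linear _ _ _ idfun) => x. Qed.

Lemma smooth_fst (R : realType) (U V : normedModType R) :
  smooth (fun p : U * V => p.1).
Proof. by apply: (@smooth_linear _ _ _ (@fst U V)) => x; exact: cvg_fst. Qed.

Lemma smooth_snd (R : realType) (U V : normedModType R) :
  smooth (fun p : U * V => p.2).
Proof. by apply: (@smooth_linear _ _ _ (@snd U V)) => x; exact: cvg_snd. Qed.

Lemma smoothD (R : realType) (U V : normedModType R) (f g : U -> V) :
  smooth f -> smooth g -> smooth (fun x => f x + g x).
Proof.
move=> sf sg; apply: (@smooth_coind _ _ _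
  [set h | exists f g, [/\ smooth f, smooth g & h = f + g]]); last by exists f, g.
- move=> _ x [a] [b] [sa sb ->]; apply: differentiableD; exact: smooth_differentiable.
- move=> _ v [a] [b] [sa sb ->].
  exists (fun y => 'D_v a y), (fun y => 'D_v b y); split; try exact: smooth_derive.
  apply/funext => y; rewrite deriveD//; apply: diff_derivable;
    exact: smooth_differentiable.
Qed.

Lemma smooth_sum (R : realType) (U V : normedModType R) (I : Type) (r : seq I)
    (f : I -> U -> V) :
  (forall i, smooth (f i)) -> smooth (fun x => \sum_(i <- r) f i x).
Proof.
move=> sf; elim: r => [|i r IH].
  by under eq_fun do rewrite big_nil; exact: smooth_cst.
by under eq_fun do rewrite big_cons; exact: smoothD.
Qed.

Lemma smooth_comp_linear (R : realType) (U V W : normedModType R)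
    (l : {linear U -> V}) (f : V -> W) :
  continuous l -> smooth f -> smooth (fun x => f (l x)).
Proof.
move=> cl sf; have dl x : differentiable l x by exact: linear_differentiable.
apply: (@smooth_coind _ _ _ [set h | exists2 f, smooth f & h = f \o l]);
  last by exists f.
- move=> _ x [g sg ->]; apply: differentiable_comp => //; exact: smooth_differentiable.
- move=> _ v [g sg ->]; exists (fun y => 'D_(l v) g y); first exact: smooth_derive.
  apply/funext => y.
  rewrite (derive_comp _ (dl y) (smooth_differentiable _ sg)).
  by rewrite [in LHS](deriveE _ (dl y)) diff_lin.
Qed.

Lemma smooth_comp_fst (R : realType) (U V W : normedModType R) (f : U -> W) :
  smooth f -> smooth (fun p : U * V => f p.1).
Proof. by apply: (@smooth_comp_linear _ _ _ _ (@fst U V)) => x; exact: cvg_fst. Qed.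

Lemma smooth_comp_snd (R : realType) (U V W : normedModType R) (f : V -> W) :
  smooth f -> smooth (fun p : U * V => f p.2).
Proof. by apply: (@smooth_comp_linear _ _ _ _ (@snd U V)) => x; exact: cvg_snd. Qed.

Lemma derive_coord (R : realType) (U : normedModType R) n m
    (f : U -> 'M[R]_(n, m)) i j x v :
  derivable f x v -> 'D_v (fun y => f y i j) x = ('D_v f x) i j.
Proof. by move=> df; rewrite derive_mx// mxE. Qed.

Lemma differentiable_coordP (R : realType) (U : normedModType R) n m
    (f : U -> 'M[R]_(n, m)) x :
  differentiable f x <-> forall i j, differentiable (fun y => f y i j) x.
Proof.
split=> [df i j|df].
  apply: (@differentiable_comp _ _ _ _ f (fun M : 'M[R]_(n, m) => M i j)) => //.
  exact: differentiable_coord.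
rewrite (_ : f = \sum_i \sum_j (fun y => f y i j *: delta_mx i j)).
  by do 2 (apply: differentiable_sum => ?); exact: differentiableZl.
apply/funext => y; rewrite fct_sumE [LHS]matrix_sum_delta.
by apply: eq_bigr => i _; rewrite fct_sumE.
Qed.

Lemma smooth_coordP (R : realType) (U : normedModType R) n m
    (f : U -> 'M[R]_(n, m)) :
  smooth f <-> forall i j, smooth (fun x => f x i j).
Proof.
split=> [sf i j|].
  apply: (@smooth_coind _ _ _
    [set h | exists2 f : U -> 'M[R]_(n, m), smooth f & h = fun x => f x i j]);
    last by exists f.
  - move=> _ x [g sg ->].
    by have /differentiable_coordP := smooth_differentiable x sg; apply.
  - move=> _ v [g sg ->]; exists (fun y => 'D_v g y); first exact: smooth_derive.
    apply/funext => y; apply: derive_coord.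
    by apply: diff_derivable; exact: smooth_differentiable.
move=> sf; apply: (@smooth_coind _ _ _
  [set f : U -> 'M[R]_(n, m) | forall i j, smooth (fun x => f x i j)]) => //.
- move=> {sf}f x sf; apply/differentiable_coordP => i j.
  exact: smooth_differentiable.
- move=> {sf}f v sf i j /=.
  rewrite (_ : (fun x => _) = (fun y => 'D_v (fun z => f z i j) y)).
    exact: smooth_derive.
  apply/funext => y; rewrite derive_coord//; apply: diff_derivable.
  by apply/differentiable_coordP => k l; exact: smooth_differentiable.
Qed.

(* The closure of these constructors under ['D_v] gives all the stability
   properties of smoothness by coinduction, without counting derivatives. *)
Inductive smooth_expr (R : realType) (U : normedModType R) (n : nat) :
    (U -> R) -> Prop :=
| SmoothAtom f : smooth f -> smooth_expr n f
| SmoothAdd f g : smooth_expr n f -> smooth_expr n g ->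
    smooth_expr n (fun x => f x + g x)
| SmoothMul f g : smooth_expr n f -> smooth_expr n g ->
    smooth_expr n (fun x => f x * g x)
| SmoothComp (h : R * 'rV[R]_n -> R) (c : U -> R) (w : U -> 'rV[R]_n) :
    smooth h -> smooth c -> smooth w -> smooth_expr n (fun x => h (c x, w x)).

Lemma smooth_expr_sum (R : realType) (U : normedModType R) n (I : Type)
    (r : seq I) (f : I -> U -> R) :
  (forall i, smooth_expr n (f i)) ->
  smooth_expr n (fun x => \sum_(i <- r) f i x).
Proof.
move=> sf; elim: r => [|i r IH].
  by under eq_fun do rewrite big_nil; apply: SmoothAtom; exact: smooth_cst.
by under eq_fun do rewrite big_cons; exact: SmoothAdd.
Qed.

(** The chain rule for [h (c x, w x)] gives a derivative of [h] in a direction that varies with x.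
    Expanding it over a basis leaves derivatives in fixed directions, which are smooth maps again
    and fit [SmoothComp]. *)
Lemma derive_split (R : realType) n (V : normedModType R)
    (h : R * 'rV[R]_n -> V) p a w : differentiable h p ->
  'D_(a, w) h p =
    a *: 'D_(1, 0) h p + \sum_i w 0 i *: 'D_(0, delta_mx 0 i) h p.
Proof.
move=> dh; have -> : (a, w) = a *: (1, 0) + \sum_i w 0 i *: (0, delta_mx 0 i)
    :> R * 'rV[R]_n.
  have -> : \sum_i w 0 i *: (0, delta_mx 0 i) =
            (0, \sum_i w 0 i *: delta_mx 0 i) :> R * 'rV[R]_n.
    elim/big_ind2 : _ => //= [x1 x2 y1 y2 -> ->|i _].
      by congr pair; rewrite /= addr0.
    by congr pair; rewrite /= scaler0.
  by rewrite -row_sum_delta; congr pair; rewrite /= ?scaler0 ?add0r// addr0 [RHS]mulr1.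
rewrite deriveDir// deriveDirZ//; congr (_ + _).
rewrite deriveE// raddf_sum; apply: eq_bigr => i _.
by rewrite -deriveDirZ// [RHS]deriveE.
Qed.

Lemma smooth_expr_closed (R : realType) (U : normedModType R) n (f : U -> R) :
  smooth_expr n f -> (forall x, differentiable f x) /\
    (forall v, smooth_expr n (fun y => 'D_v f y)).
Proof.
elim=> {f} [f sf|f g Ef [df Df] Eg [dg Dg]|f g Ef [df Df] Eg [dg Dg]|h c w sh sc sw].
- by split=> [x|v]; [exact: smooth_differentiable|
                     exact/SmoothAtom/smooth_derive].
- split=> [x|v]; first exact: differentiableD.
  rewrite (_ : (fun y => _) = fun y => 'D_v f y + 'D_v g y).
    exact: SmoothAdd.
  by apply/funext => y; rewrite deriveD//; exact: diff_derivable.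
- split=> [x|v]; first exact: differentiableM.
  rewrite (_ : (fun y => _) = fun y => f y * 'D_v g y + g y * 'D_v f y).
    by apply: SmoothAdd; exact: SmoothMul.
  by apply/funext => y; rewrite deriveM//; exact: diff_derivable.
- have dcw x : differentiable (fun x => (c x, w x)) x.
    by apply: differentiable_pair; exact: smooth_differentiable.
  split=> [x|v].
    apply: (@differentiable_comp _ _ _ _ (fun x => (c x, w x))) => //.
    exact: smooth_differentiable.
  rewrite (_ : (fun y => _) = fun y => 'D_v c y * 'D_(1, 0) h (c y, w y) +
     \sum_i ('D_v w y) 0 i * 'D_(0, delta_mx 0 i) h (c y, w y)).
    apply: SmoothAdd.
      apply: SmoothMul; first exact/SmoothAtom/smooth_derive.
      by apply: (@SmoothComp _ _ _ (fun p => 'D_(1, 0) h p)) => //;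
        exact: smooth_derive.
    apply: smooth_expr_sum => i; apply: SmoothMul.
      by have /smooth_coordP sw' := smooth_derive v sw; exact: SmoothAtom.
    by apply: (@SmoothComp _ _ _ (fun p => 'D_(0, delta_mx 0 i) h p)) => //;
      exact: smooth_derive.
  apply/funext => y.
  rewrite (derive_comp _ (dcw y) (smooth_differentiable _ sh)).
  rewrite derive_pair; try exact: smooth_differentiable.
  by rewrite derive_split//; exact: smooth_differentiable.
Qed.

Lemma smooth_expr_smooth (R : realType) (U : normedModType R) n (f : U -> R) :
  smooth_expr n f -> smooth f.
Proof.
apply: (@smooth_coind _ _ _ (@smooth_expr R U n)).
- by move=> g x /smooth_expr_closed[].
- by move=> g v /smooth_expr_closed[].
Qed.

Lemma smoothM (R : realType) (U : normedModType R) (f g : U -> R) :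
  smooth f -> smooth g -> smooth (fun x => f x * g x).
Proof.
by move=> sf sg; apply: (@smooth_expr_smooth _ _ 0); apply: SmoothMul;
  apply: SmoothAtom.
Qed.

Lemma smoothZ (R : realType) (U : normedModType R) n m (k : U -> R)
    (f : U -> 'M[R]_(n, m)) :
  smooth k -> smooth f -> smooth (fun x => k x *: f x).
Proof.
move=> sk /smooth_coordP sf; apply/smooth_coordP => i j.
by under eq_fun do rewrite mxE; exact: smoothM.
Qed.

Lemma smooth_comp (R : realType) (U : normedModType R) n m k
    (h : R * 'rV[R]_n -> 'M[R]_(m, k)) (c : U -> R) (w : U -> 'rV[R]_n) :
  smooth h -> smooth c -> smooth w -> smooth (fun x => h (c x, w x)).
Proof.
move=> /smooth_coordP sh sc sw; apply/smooth_coordP => i j.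
exact/smooth_expr_smooth/(SmoothComp (sh i j)).
Qed.

Lemma smoothX (R : realType) (U : normedModType R) (f : U -> R) k :
  smooth f -> smooth (fun x => f x ^+ k).
Proof.
move=> sf; elim: k => [|k IH].
  by under eq_fun do rewrite expr0; exact: smooth_cst.
by under eq_fun do rewrite exprS; exact: smoothM.
Qed.

(** * Symmetry of second derivatives *)

Lemma differentiable_line (R : realType) (U : normedModType R) (y v : U) (s : R) :
  differentiable (fun r : R => y + r *: v) s.
Proof. by apply: differentiableD => //; exact: differentiableZl. Qed.

Lemma derive_line (R : realType) (U : normedModType R) (y v : U) (s : R) :
  'D_1 (fun r : R => y + r *: v) s = v.
Proof.
have ds : differentiable (fun r : R => r *: v) s by exact: differentiableZl.
rewrite deriveD; [|exact: derivable_cst|exact: diff_derivable].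
by rewrite derive_cst add0r deriveE// diff_val scale1r.
Qed.

Lemma is_derive_along (R : realType) (U V : normedModType R) (f : U -> V)
    (y v : U) (s : R) : differentiable f (y + s *: v) ->
  is_derive s 1 (fun r : R => f (y + r *: v)) ('D_v f (y + s *: v)).
Proof.
move=> df; have dl := differentiable_line y v s.
rewrite -[v in 'D_v f _](derive_line y v s) -(derive_comp (1 : R) dl df).
by apply/derivableP/diff_derivable; exact: (differentiable_comp dl df).
Qed.

Lemma MVT_along (R : realType) (U : normedModType R) (f : U -> R) (y v : U)
    (h : R) : (forall z, differentiable f z) -> 0 < h ->
  exists2 s, 0 <= s <= h & f (y + h *: v) - f y = h * 'D_v f (y + s *: v).
Proof.
move=> df h0.
have [s|s sh Es] := @MVT _ (fun s => f (y + s *: v))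
  (fun s => 'D_v f (y + s *: v)) _ _ h0 (fun s _ => is_derive_along (df _)).
  apply: continuous_subspaceT => {}s; apply: differentiable_continuous.
  exact: (differentiable_comp (differentiable_line y v s) (df _)).
exists s; first by move: sh; rewrite in_itv/= => /andP[/ltW -> /ltW].
by move: Es; rewrite scale0r addr0 subr0 mulrC.
Qed.

(** The mean value theorem is applied along [v] to the increment of [f] by [h *: w], then along [w]
    to the derivative of [f] along [v]. The left side is symmetric in [v] and [w], which is what
    makes the two mixed derivatives comparable. *)
Lemma second_difference (R : realType) (U : normedModType R) (f : U -> R)
    (x v w : U) (h : R) : smooth f -> 0 < h ->
  exists s t, [/\ 0 <= s <= h, 0 <= t <= h &
    f (x + h *: v + h *: w) - f (x + h *: v) - (f (x + h *: w) - f x) =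
    h * (h * 'D_w (fun y => 'D_v f y) (x + s *: v + t *: w))].
Proof.
move=> sf h0; have df z := smooth_differentiable z sf.
have dt z : differentiable (fun y : U => y + h *: w) z.
  by apply: differentiableD => //; exact: differentiable_cst.
have dsh z : differentiable (fun y => f (y + h *: w)) z.
  exact: (differentiable_comp (dt z) (df _)).
have [s sh Es] := MVT_along x v (fun z => differentiableB (dsh z) (df z)) h0.
have [t th Et] := MVT_along (x + s *: v) w
  (fun z => smooth_differentiable z (smooth_derive v sf)) h0.
exists s, t; split => //; rewrite -Et.
have Ev z : 'D_v (fun y : U => y + h *: w) z = v.
  rewrite deriveD; [|exact: derivable_id|exact: derivable_cst].
  by rewrite derive_id derive_cst addr0.
have Ef z : 'D_v (fun y => f (y + h *: w)) z = 'D_v f (z + h *: w).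
  by rewrite -[v in RHS](Ev z); exact: derive_comp (dt z) (df _).
rewrite [LHS]Es deriveB; [|exact/diff_derivable..].
by rewrite Ef.
Qed.

Lemma ler_dist_via (R : realFieldType) (a b c e : R) :
  `|c - a| < e / 2 -> `|c - b| < e / 2 -> `|a - b| <= e.
Proof.
move=> H1 H2; rewrite (splitr e) -(subrKA c) (le_trans (ler_normD _ _))//.
by rewrite lerD ?ltW// distrC.
Qed.

Lemma schwarz_real (R : realType) (U : normedModType R) (f : U -> R) (x v w : U) :
  smooth f -> 'D_v (fun y => 'D_w f y) x = 'D_w (fun y => 'D_v f y) x.
Proof.
move=> sf; set a := LHS; set b := RHS.
have lim (g : U -> R) : smooth g -> forall e, 0 < e -> exists2 d, 0 < d &
    forall z, `|z| < d -> `|g (x + z) - g x| < e.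
  move=> sg e e0; have /differentiable_continuous := smooth_differentiable x sg.
  move/cvgrPdist_lt => /(_ _ e0)/nbhs_ballP[d/= d0 dP]; exists d => // z zd.
  rewrite distrC; apply: dP; rewrite -ball_normE/= opprD addrA subrr add0r.
  by rewrite normrN.
apply/eqP; rewrite -subr_eq0 -normr_eq0; apply/eqP/le_anti/andP; split=> //.
apply/ler_addgt0Pl => e e0; rewrite addr0.
have e2 : 0 < e / 2 by rewrite divr_gt0.
have [d1 d10 H1] := lim _ (smooth_derive v (smooth_derive w sf)) _ e2.
have [d2 d20 H2] := lim _ (smooth_derive w (smooth_derive v sf)) _ e2.
pose d := Num.min d1 d2; have d0 : 0 < d by rewrite lt_min d10.
(* The summand 1 keeps [N] positive when both directions vanish, and makes the bound on the
   displacement strict. *)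
pose N := `|v| + `|w| + 1; have N0 : 0 < N by rewrite ltr_wpDl// addr_ge0.
pose h := d / N; have h0 : 0 < h by rewrite divr_gt0.
have small s t : 0 <= s <= h -> 0 <= t <= h -> `|s *: v + t *: w| < d.
  move=> /andP[s0 sh] /andP[t0 th].
  rewrite (le_lt_trans (ler_normD _ _))// !normrZ (ger0_norm s0) (ger0_norm t0).
  rewrite (@le_lt_trans _ _ (h * (`|v| + `|w|)))//.
    by rewrite mulrDr lerD// ler_wpM2r.
  by rewrite /h mulrAC ltr_pdivrMr// ltr_pM2l// /N ltrDl.
have [s [t [sh th E1]]] := second_difference x v w sf h0.
have [t' [s' [th' sh' E2]]] := second_difference x w v sf h0.
(* Both sides are the same second difference divided by h^2; only the intermediate points depend on
   the order of the directions. *)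
have E : 'D_w (fun y => 'D_v f y) (x + (s *: v + t *: w)) =
         'D_v (fun y => 'D_w f y) (x + (s' *: v + t' *: w)).
  rewrite addrA [in RHS](addrC (s' *: v)) addrA.
  apply: (mulfI (lt0r_neq0 h0)); apply: (mulfI (lt0r_neq0 h0)).
  apply: etrans (esym E1) (etrans _ E2); rewrite (addrAC x (h *: w)).
  by move: (f _) (f _) (f _) (f _) => r1 r2 r3 r4; ring.
have dd1 : d <= d1 by rewrite ge_min lexx.
have dd2 : d <= d2 by rewrite ge_min lexx orbT.
have {H1} := H1 _ (lt_le_trans (small _ _ sh' th') dd1).
have {H2} := H2 _ (lt_le_trans (small _ _ sh th) dd2).
rewrite E -/a -/b => H2 H1; exact: (ler_dist_via H1 H2).
Qed.

Lemma schwarz (R : realType) (U : normedModType R) n m (f : U -> 'M[R]_(n, m))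
    (x v w : U) :
  smooth f -> 'D_v (fun y => 'D_w f y) x = 'D_w (fun y => 'D_v f y) x.
Proof.
move=> sf; have der u z : derivable f z u.
  exact/diff_derivable/smooth_differentiable.
have der2 u u' z : derivable (fun y => 'D_u f y) z u'.
  exact/diff_derivable/smooth_differentiable/smooth_derive.
apply/matrixP => i j.
have E u u' : 'D_u (fun y => 'D_u' (fun z => f z i j) y) x =
              ('D_u (fun y => 'D_u' f y) x) i j.
  rewrite -(derive_coord i j (der2 u' u x)); congr ('D_u _ x).
  by apply/funext => y; exact: derive_coord.
have sfij : smooth (fun z => f z i j) by have /smooth_coordP := sf; apply.
exact: etrans (esym (E v w)) (etrans (schwarz_real x v w sfij) (E w v)).
Qed.

(** * Time-dependent vector fields and their push-forwards *)

(** The smoothness clause of [tdep] alone, so that it also applies to families outside V, such as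
    the diffeomorphisms of a generalised flow and their inverses. *)
Definition jsmooth (R : realType) (n : nat) (X : R -> vfield R n) : Prop :=
  smooth (fun p : R * 'rV[R]_n => X p.1 p.2).

Definition ddt (R : realType) (n : nat) (X : R -> vfield R n) : R -> vfield R n :=
  fun t x => derive1 (fun s => X s x) t.

Section Joint.
Variables (R : realType) (n : nat).
Implicit Types (X Y Z : R -> vfield R n) (t : R) (x v : 'rV[R]_n).

Let J X (p : R * 'rV[R]_n) := X p.1 p.2.

Lemma jsmooth_differentiable X t x : jsmooth X -> differentiable (X t) x.
Proof.
move=> sX; apply: (@differentiable_comp _ _ _ _ (fun y => (t, y)) (J X)).
  by apply: differentiable_pair => //; exact: differentiable_cst.
exact: smooth_differentiable.
Qed.

Lemma jsmooth_differentiable1 X t x : jsmooth X ->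
  differentiable (fun s => X s x) t.
Proof.
move=> sX; apply: (@differentiable_comp _ _ _ _ (fun s => (s, x)) (J X)).
  by apply: differentiable_pair => //; exact: differentiable_cst.
exact: smooth_differentiable.
Qed.

Lemma jsmooth_derivable1 X t x : jsmooth X -> derivable (fun s => X s x) t 1.
Proof. by move=> sX; exact/diff_derivable/jsmooth_differentiable1. Qed.

Lemma derive_jsnd X t x v : jsmooth X -> 'D_v (X t) x = 'D_(0, v) (J X) (t, x).
Proof.
move=> sX; have dp : differentiable (fun y : 'rV[R]_n => (t, y)) x.
  by apply: differentiable_pair => //; exact: differentiable_cst.
have E : 'D_v (fun y : 'rV[R]_n => (t, y)) x = (0, v).
  by rewrite derive_pair ?derive_cst ?derive_id//; exact: differentiable_cst.
by rewrite -E; exact: (derive_comp v dp (smooth_differentiable _ sX)).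
Qed.

Lemma derive_curve X (w : R -> 'rV[R]_n) t : jsmooth X -> differentiable w t ->
  derive1 (fun s => X s (w s)) t = 'D_(1, derive1 w t) (J X) (t, w t).
Proof.
move=> sX dw; have dp : differentiable (fun s : R => (s, w s)) t.
  by apply: differentiable_pair.
have E : 'D_1 (fun s : R => (s, w s)) t = (1, derive1 w t).
  have di := smooth_differentiable t (@smooth_id R R).
  by rewrite derive1E (derive_pair (1 : R) di dw); congr pair; exact: derive_id.
by rewrite -E derive1E; exact: (derive_comp (1 : R) dp (smooth_differentiable _ sX)).
Qed.

Lemma ddtE X t x : jsmooth X -> ddt X t x = 'D_(1, 0) (J X) (t, x).
Proof.
move=> sX; rewrite /ddt (derive_curve sX); last exact: differentiable_cst.
by rewrite derive1_cst.
Qed.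

Lemma ddt_curve X (w : R -> 'rV[R]_n) t : jsmooth X -> differentiable w t ->
  derive1 (fun s => X s (w s)) t =
  ddt X t (w t) + 'D_(derive1 w t) (X t) (w t).
Proof.
move=> sX dw; rewrite derive_curve// ddtE// derive_jsnd// -deriveDir.
  by congr ('D_ _ _ _); congr pair; rewrite /= ?addr0 ?add0r.
exact: smooth_differentiable.
Qed.

Lemma jsmooth_ddt X : jsmooth X -> jsmooth (ddt X).
Proof.
move=> sX; rewrite /jsmooth.
rewrite (_ : (fun p => _) = fun p => 'D_(1, 0) (J X) p).
  exact: smooth_derive.
by apply/funext => -[t x]; rewrite ddtE.
Qed.

Lemma jsmooth_comp X Z : jsmooth X -> jsmooth Z ->
  jsmooth (fun t x => X t (Z t x)).
Proof.
move=> sX sZ.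
by apply: (@smooth_comp _ _ _ _ _ (J X)) => //; exact: smooth_fst.
Qed.

Lemma jsmooth_cst (X : vfield R n) : smooth X -> jsmooth (fun=> X).
Proof. exact: smooth_comp_snd. Qed.

Lemma jsmoothD X Z : jsmooth X -> jsmooth Z -> jsmooth (fun t => X t + Z t).
Proof. exact: smoothD. Qed.

Lemma jsmoothZ (f : R -> R) X : smooth f -> jsmooth X ->
  jsmooth (fun t => f t *: X t).
Proof. by move=> sf sX; apply: smoothZ => //; exact: smooth_comp_fst. Qed.

Lemma jsmooth_curve X (w : R -> 'rV[R]_n) : jsmooth X -> smooth w ->
  smooth (fun t => X t (w t)).
Proof.
by move=> sX sw; apply: (@smooth_comp _ _ _ _ _ (J X)) => //; exact: smooth_id.
Qed.

Lemma jsmooth_dir X v : jsmooth X -> jsmooth (fun t x => 'D_v (X t) x).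
Proof.
move=> sX; rewrite /jsmooth (_ : (fun p => _) = fun p => 'D_(0, v) (J X) p).
  exact: smooth_derive.
by apply/funext => -[t x]; rewrite derive_jsnd.
Qed.

(** Trades a direction that depends on the point for fixed ones, to which [smooth_derive]
    applies. *)
Lemma derive_sum_delta (f : 'rV[R]_n -> 'rV[R]_n) x v : differentiable f x ->
  'D_v f x = \sum_i v 0 i *: 'D_(delta_mx 0 i) f x.
Proof.
move=> df; rewrite [in LHS](row_sum_delta v) deriveE// raddf_sum.
by apply: eq_bigr => i _; rewrite -deriveDirZ// [RHS]deriveE.
Qed.

Lemma jsmooth_derive X Z : jsmooth X -> jsmooth Z ->
  jsmooth (fun t x => 'D_(Z t x) (X t) x).
Proof.
move=> sX sZ; rewrite /jsmooth (_ : (fun p => _) =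
  fun p => \sum_i (J Z p) 0 i *: 'D_(delta_mx 0 i) (X p.1) p.2); last first.
  by apply/funext => -[t x]; apply/derive_sum_delta/jsmooth_differentiable.
apply: smooth_sum => i; apply: smoothZ; last exact: jsmooth_dir.
by have /smooth_coordP := sZ; apply.
Qed.

Lemma jsmooth_bracket X Z : jsmooth X -> jsmooth Z ->
  jsmooth (fun t => bracket (X t) (Z t)).
Proof.
move=> sX sZ; apply: jsmoothD; first exact: jsmooth_derive.
rewrite /jsmooth (_ : (fun p => _) = fun p => (-1) *: 'D_(Z p.1 p.2) (X p.1) p.2).
  by apply: smoothZ; [exact: smooth_cst|exact: jsmooth_derive].
by apply/funext => p; rewrite scaleN1r.
Qed.

(** At fixed [x] the map [H s v] is linear in [v], so the derivative of [H s (Z s x)] splits into a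
    change of [H] and a change of the direction. Symmetry of second derivatives moves the time
    derivative inside the first term. *)
Lemma ddt_derive X Z t x : jsmooth X -> jsmooth Z ->
  ddt (fun t x => 'D_(Z t x) (X t) x) t x =
  'D_(Z t x) (ddt X t) x + 'D_(ddt Z t x) (X t) x.
Proof.
move=> sX sZ; pose H s v := 'D_v (X s) x.
have sH : jsmooth H.
  rewrite /jsmooth (_ : (fun p => _) =
      fun p : R * 'rV[R]_n => \sum_i p.2 0 i *: 'D_(delta_mx 0 i) (X p.1) x).
    apply: smooth_sum => i; apply: smoothZ.
      by have /smooth_coordP := @smooth_snd R R 'rV[R]_n; apply.
    have sd := jsmooth_curve (jsmooth_dir (delta_mx 0 i) sX) (@smooth_cst R R _ x).
    exact: (@smooth_comp_fst _ _ _ _ _ sd).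
  apply/funext => -[s v]; apply: derive_sum_delta.
  exact: jsmooth_differentiable.
have dX : differentiable (X t) x by exact: jsmooth_differentiable.
have Hlin v w : 'D_w (H t) v = H t w.
  rewrite /H deriveE; last exact: jsmooth_differentiable sH.
  have -> : (fun v => 'D_v (X t) x) = 'd (X t) x.
    by apply/funext => u; rewrite deriveE.
  by rewrite diff_lin ?deriveE//; exact: diff_continuous.
have ddtH v : ddt H t v = 'D_v (ddt X t) x.
  rewrite -[ddt H t v]/(ddt (fun t x => 'D_v (X t) x) t x).
  rewrite (ddtE t x (jsmooth_dir v sX)).
  have -> : J (fun t x => 'D_v (X t) x) = (fun p => 'D_(0, v) (J X) p).
    by apply/funext => -[s u]; exact: (derive_jsnd s u v sX).
  rewrite (schwarz _ _ _ sX).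
  have -> : (fun p => 'D_(1, 0) (J X) p) = J (ddt X).
    by apply/funext => -[s u]; exact: esym (ddtE s u sX).
  exact: esym (derive_jsnd t x v (jsmooth_ddt sX)).
have E := ddt_curve sH (jsmooth_differentiable1 t x sZ).
by rewrite ddtH Hlin in E; exact: E.
Qed.

Lemma smooth_jsmooth X t : jsmooth X -> smooth (X t).
Proof.
by move=> sX; apply: (@smooth_comp _ _ _ _ _ (J X)) => //;
  [exact: smooth_cst|exact: smooth_id].
Qed.

End Joint.

Section Pushforward.
Variables (R : realType) (n : nat).
Implicit Types (X Y Z : R -> vfield R n) (t : R) (x v : 'rV[R]_n)
  (g : R -> diffeo R n).

Lemma jsmooth_pushforward g X :
  jsmooth (fun t => dmap (g t)) -> jsmooth (fun t => dinv (g t)) ->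
  jsmooth X -> jsmooth (fun t => pushforward (g t) (X t)).
Proof.
move=> sg si sX.
exact: (jsmooth_comp (jsmooth_derive sg sX) si).
Qed.

Lemma pushforward_dmap (g : diffeo R n) (X : vfield R n) x :
  pushforward g X (g x) = 'D_(X x) g x.
Proof. by rewrite /pushforward dmapK. Qed.

(* Both sides of D(g_t) X_t = (g_{t*} X_t) o g_t are differentiated in t. *)
Lemma ddt_pushforward g X Y t :
  jsmooth (fun t => dmap (g t)) -> jsmooth (fun t => dinv (g t)) ->
  jsmooth X -> jsmooth Y ->
  (forall t x, derive1 (fun s => g s x) t = Y t (g t x)) ->
  ddt (fun t => pushforward (g t) (X t)) t =
  pushforward (g t) (ddt X t) - bracket (Y t) (pushforward (g t) (X t)).
Proof.
move=> sg si sX sY gE; set P := fun t => pushforward (g t) (X t).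
have sP : jsmooth P by exact: jsmooth_pushforward.
have dg s x : differentiable (g s) x := jsmooth_differentiable s x sg.
apply/funext => z; rewrite -[z](dinvK (g t)); set y := dinv (g t) z.
have right : derive1 (fun s => P s (g s y)) t =
    ddt P t (g t y) + 'D_(Y t (g t y)) (P t) (g t y).
  have dgy := jsmooth_differentiable1 t y sg.
  have E1 := ddt_curve sP dgy.
  by rewrite -(gE t y); exact: E1.
have left : derive1 (fun s => 'D_(X s y) (g s) y) t =
    'D_(P t (g t y)) (Y t) (g t y) + pushforward (g t) (ddt X t) (g t y).
  have E := ddt_derive t y sg sX.
  have E1 : ddt (fun t => dmap (g t)) t = fun x => Y t (g t x).
    by apply/funext => x; exact: gE.
  have E2 : 'D_(X t y) (fun x => Y t (g t x)) y =
      'D_('D_(X t y) (g t) y) (Y t) (g t y).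
    exact: derive_comp (dg t y) (jsmooth_differentiable _ _ sY).
  have EP : P t (g t y) = 'D_(X t y) (g t) y by exact: pushforward_dmap.
  by rewrite EP pushforward_dmap -E2 -E1; exact: E.
have E : (fun s => P s (g s y)) = (fun s => 'D_(X s y) (g s) y).
  by apply/funext => s; rewrite /P pushforward_dmap.
have sub_eq (V : zmodType) (p q r a : V) : r + a = p + q -> p = a - (q - r).
  by move=> pq; rewrite opprB addrCA addrA pq addrK.
by rewrite E left in right; exact: sub_eq right.
Qed.

End Pushforward.

(** * Coordinates on a finite-dimensional space of vector fields *)

Section Coordinates.
Variables (R : realType) (n : nat).
Implicit Types (X Y : vfield R n) (V : set (vfield R n)).

(** The index is a point of R^n with a component number, so that the value is a scalar and [ev xi]
    is a linear functional on fields. *)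
Definition ev (xi : 'rV[R]_n * 'I_n) X : R := X xi.1 0 xi.2.

Lemma evD xi X Y : ev xi (X + Y) = ev xi X + ev xi Y.
Proof. by rewrite /ev /= mxE. Qed.

Lemma evZ xi k X : ev xi (k *: X) = k * ev xi X.
Proof. by rewrite /ev /= mxE. Qed.

Lemma ev0 xi : ev xi (0 : vfield R n) = 0.
Proof. by rewrite -(scale0r (0 : vfield R n)) evZ mul0r. Qed.

Lemma evN xi X : ev xi (- X) = - ev xi X.
Proof. by rewrite -scaleN1r evZ mulN1r. Qed.

Lemma evB xi X Y : ev xi (X - Y) = ev xi X - ev xi Y.
Proof. by rewrite evD evN. Qed.

Lemma ev_sum xi (I : Type) (r : seq I) (F : I -> vfield R n) :
  ev xi (\sum_(i <- r) F i) = \sum_(i <- r) ev xi (F i).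
Proof.
elim/big_rec2 : _ => [|i x y _ <-]; last exact: evD.
by rewrite /ev /= mxE.
Qed.

Lemma evP X Y : (forall xi, ev xi X = ev xi Y) -> X = Y.
Proof.
by move=> XY; apply/funext => x; apply/rowP => i; exact: (XY (x, i)).
Qed.

(* Choosing evaluation functionals as coordinates on V makes them commute with
   every pointwise operation, in particular with differentiation in time. *)
Lemma fd_subspace_dual V : fd_subspace V ->
  exists (m : nat) (xi : 'I_m -> 'rV[R]_n * 'I_n) (lam : 'I_m -> vfield R n),
    [/\ forall k, V (lam k),
        forall k l, ev (xi l) (lam k) = (k == l)%:R &
        forall X, V X -> X = \sum_k ev (xi k) X *: lam k].
Proof.
move=> [r [b ->{V}]]; elim: r b => [|r IH] b.
  exists 0, (fun i : 'I_0 => match notF (valP i) return _ with end), (fun=> 0).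
  split=> [[]//|[]//|X [c ->]].
  by rewrite !big_ord0.
have [b0|/eqP/negP b0] := pselect (b ord0 = 0).
  have [m [xi [lam [lamV dual repr]]]] := IH (fun i => b (lift ord0 i)).
  exists m, xi, lam; split => // [k|X [c ->]].
    have [c ->] := lamV k.
    exists (fun i => oapp c 0 (unlift ord0 i)).
    rewrite big_ord_recl unlift_none scale0r add0r.
    by apply: eq_bigr => i _; rewrite liftK.
  apply: repr; exists (fun i => c (lift ord0 i)).
  by rewrite big_ord_recl b0 scaler0 add0r.
have [x0 x0b] : exists x, ev x (b ord0) != 0.
  apply/not_existsP => h; apply: b0; apply/eqP/evP => x.
  have /negP/negPn/eqP -> := h x.
  by rewrite /ev /= mxE.
(* Gaussian elimination with pivot [x0]: the other generators are corrected to vanish under [ev x0]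
   before the induction hypothesis is applied to them, and [l1] is then [l0] freed of its components
   along [lam]. *)
pose l0 := (ev x0 (b ord0))^-1 *: b ord0.
have l01 : ev x0 l0 = 1 by rewrite evZ mulVf.
have [m [xi [lam [lamV dual repr]]]] :=
  IH (fun i => b (lift ord0 i) - ev x0 (b (lift ord0 i)) *: l0).
have lam0 k : ev x0 (lam k) = 0.
  have [c ->] := lamV k; rewrite ev_sum big1// => i _.
  by rewrite evZ evB evZ l01 mulr1 subrr mulr0.
pose l1 := l0 - \sum_k ev (xi k) l0 *: lam k.
have spanD X Y : (exists c, X = \sum_(i < r.+1) c i *: b i) ->
   (exists c, Y = \sum_(i < r.+1) c i *: b i) -> forall k,
   exists c, X + k *: Y = \sum_(i < r.+1) c i *: b i.
  move=> [c ->] [d ->] k; exists (fun i => c i + k * d i).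
  rewrite scaler_sumr -big_split; apply: eq_bigr => i _.
  by rewrite scalerDl scalerA.
have span0 : exists c, 0 = \sum_(i < r.+1) c i *: b i.
  by exists (fun=> 0); rewrite big1// => i _; rewrite scale0r.
have spanb j : exists c, b j = \sum_(i < r.+1) c i *: b i.
  exists (fun i => (i == j)%:R); rewrite (bigD1 j)//= eqxx scale1r big1 ?addr0//.
  by move=> i /negbTE ->; rewrite scale0r.
have spanS (I : Type) (s : seq I) (f : I -> vfield R n) (k : I -> R) :
  (forall i, exists c, f i = \sum_(i < r.+1) c i *: b i) ->
  exists c, \sum_(i <- s) k i *: f i = \sum_(i < r.+1) c i *: b i.
  move=> fb; elim/big_ind : _ => // [X Y Xb Yb|i _].
    by rewrite -[Y]scale1r; exact: spanD.
  by rewrite -[X in exists c, X = _]add0r; exact: spanD.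
have spanl0 : exists c, l0 = \sum_(i < r.+1) c i *: b i.
  by rewrite -[l0]add0r; exact: spanD.
have spanlam k : exists c, lam k = \sum_(i < r.+1) c i *: b i.
  have [c ->] := lamV k; apply: spanS => i.
  by rewrite -scaleNr; exact: spanD.
have bl0 : ev x0 (b ord0) *: l0 = b ord0 by rewrite scalerA divff// scale1r.
clearbody l0.
exists m.+1, (fun i => oapp xi x0 (unlift ord0 i)),
  (fun i => oapp lam l1 (unlift ord0 i)); split => [k|k l|X [c EX]].
- case: unliftP => [j _|_] /=; first exact: spanlam.
  by rewrite /l1 -scaleN1r; apply: spanD => //; exact: spanS.
- case: (unliftP ord0 k) => [j ->|->]; case: (unliftP ord0 l) => [i ->|->] /=.
  + by rewrite dual (inj_eq (@lift_inj _ _)).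
  + by rewrite lam0.
  + rewrite /l1 evB ev_sum (bigD1 i)//= evZ dual eqxx mulr1 big1 ?addr0 ?subrr//.
    by move=> j /negbTE ji; rewrite evZ dual ji mulr0.
  + rewrite /l1 evB ev_sum l01 big1 ?subr0// => j _.
    by rewrite evZ lam0 mulr0.
- rewrite big_ord_recl unlift_none /=.
  under eq_bigr do rewrite liftK /=.
  have /eqP : X - ev x0 X *: l0 =
      \sum_k ev (xi k) (X - ev x0 X *: l0) *: lam k.
    apply: repr; exists (fun i => c (lift ord0 i)).
    rewrite EX big_ord_recl evD evZ scalerDl opprD addrACA -scalerA bl0 subrr.
    rewrite add0r ev_sum scaler_suml -sumrB; apply: eq_bigr => i _.
    by rewrite evZ scalerBr scalerA.
  rewrite subr_eq => /eqP {1}->.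
  rewrite addrC /l1 scalerBr -addrA; congr (_ + _).
  rewrite scaler_sumr addrC -sumrB; apply: eq_bigr => k _.
  by rewrite evB evZ scalerBl scalerA.
Qed.

End Coordinates.

(** * Linear differential equations *)

(* Gronwall: the sum of squares u of a solution satisfies u' <= 2 K u, so
   exp(- 2 K t) u(t) is nonincreasing. *)
Lemma linear_ode_ge0 (R : realType) m (A : R -> 'I_m -> 'I_m -> R)
    (q : 'I_m -> R -> R) :
  (forall k l, continuous (fun t => A t k l)) ->
  (forall k (t : R), is_derive t 1 (q k) (\sum_l A t k l * q l t)) ->
  (forall k, q k 0 = 0) -> forall k t, 0 <= t -> q k t = 0.
Proof.
move=> cA dq q0 k t t0.
pose S s := \sum_k \sum_l `|A s k l|.
have cS : continuous S.
  apply: continuous_big => [|i _]; first exact: add_continuous.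
  apply: continuous_big => [|j _ s]; first exact: add_continuous.
  by apply: cvg_norm; exact: cA.
(* The coefficients are merely continuous, so the Gronwall constant is the maximum over the compact
   interval from 0 to [t] of the sum of their absolute values. *)
have [c _ Sc] := EVT_max t0 (continuous_subspaceT cS).
pose K := S c; pose u s := \sum_k q k s ^+ 2.
pose du s := \sum_k (2 * q k s * \sum_l A s k l * q l s).
have u_ge0 s : 0 <= u s by apply: sumr_ge0 => i _; exact: sqr_ge0.
have qu i s : q i s ^+ 2 <= u s.
  by rewrite /u (bigD1 i)//= lerDl; apply: sumr_ge0 => j _; exact: sqr_ge0.
have duP (s : R) : is_derive s 1 u (du s).
  have -> : u = \sum_k (fun s => q k s ^+ 2).
    by apply/funext => r; rewrite fct_sumE.
  apply: is_derive_sum => i; have -> : (fun s => q i s ^+ 2) = q i * q i.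
    by apply/funext => r; rewrite expr2.
  by apply: is_derive_eq; rewrite /GRing.scale/=; ring.
have du_le s : s \in `[0, t] -> du s <= 2 * K * u s.
  move=> sI; have Ks : S s <= K := Sc s sI.
  apply: (@le_trans _ _ (2 * S s * u s)); last first.
    by apply: ler_wpM2r => //; rewrite ler_pM2l.
  rewrite /du /S -mulrA mulr_suml mulr_sumr; apply: ler_sum => i _.
  rewrite -mulrA ler_pM2l// mulr_sumr mulr_suml; apply: ler_sum => j _.
  rewrite mulrCA (le_trans (ler_norm _))// normrM ler_wpM2l//.
  (* A product of two numbers whose squares are at most [w] lies between [- w] and [w]. *)
  have := qu i s; have := qu j s; move: (q i s) (q j s) (u s) => a b w wb wa.
  rewrite ler_norml; apply/andP; split; nra.
pose v s := expR (- (2 * K) * s) * u s.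
have dv (s : R) : is_derive s 1 v (expR (- (2 * K) * s) * (du s - 2 * K * u s)).
  have dl : is_derive s 1 (fun r : R => - (2 * K) * r) (- (2 * K)).
    by apply: is_derive_eq; rewrite /GRing.scale/= mulr1.
  have de := is_derive1_comp (is_derive_expR (- (2 * K) * s)) dl.
  have dv1 : is_derive s 1 v _ := is_deriveM de (duP s).
  by apply: (is_derive_eq dv1); rewrite /GRing.scale/=; ring.
have vt : v t <= v 0.
  have cv : {within `[0, t], continuous v}.
    apply: continuous_subspaceT => s; apply: differentiable_continuous.
    by apply/derivable1_diffP; have [] := dv s.
  have v'le0 s : s \in `]0, t[ -> derive1 v s <= 0.
    move=> sI; rewrite derive1E (@derive_val _ _ _ _ _ _ _ (dv s)).
    rewrite mulr_ge0_le0 ?expR_ge0// subr_le0 du_le//.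
    by move: sI; rewrite !in_itv/= => /andP[/ltW -> /ltW].
  have v'd s : s \in `]0, t[ -> derivable v s 1 by have [] := dv s.
  by apply: (ler0_derive1_le_cc v'd v'le0 cv) => //; rewrite in_itv/= ?lexx t0.
have v0 : v 0 = 0.
  by rewrite /v /u big1 ?mulr0// => i _; rewrite q0 expr0n.
move: vt; rewrite v0 /v pmulr_rle0 ?expR_gt0// => ut.
have := le_trans (qu k t) ut.
by move=> h; apply/eqP; rewrite -sqrf_eq0 eq_le h sqr_ge0.
Qed.

(** Negative times are reached by reversing time, which replaces A(s) by - A(- s). *)
Lemma linear_ode_unique (R : realType) m (A : R -> 'I_m -> 'I_m -> R)
    (q : 'I_m -> R -> R) :
  (forall k l, continuous (fun t => A t k l)) ->
  (forall k (t : R), is_derive t 1 (q k) (\sum_l A t k l * q l t)) ->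
  (forall k, q k 0 = 0) -> forall k t, q k t = 0.
Proof.
move=> cA dq q0 k t; have [t0|t0] := leP 0 t; first exact: linear_ode_ge0 t0.
rewrite -(opprK t).
apply: (@linear_ode_ge0 _ _ (fun s k l => - A (- s) k l) (fun k s => q k (- s)))
  => //; last by rewrite oppr_ge0 ltW.
- move=> i j s; apply: cvgN.
  apply: (@continuous_comp _ _ _ -%R (fun s => A s i j)); last exact: cA.
  exact: opp_continuous.
- move=> i s.
  have dN : is_derive s 1 (-%R : R -> R) (-1) by exact: is_deriveNid.
  apply: (is_derive_eq (is_derive1_comp (dq i (- s)) dN)).
  rewrite mulrN1 -sumrN; apply: eq_bigr => j _; by rewrite mulNr.
- by move=> i; rewrite oppr0.
Qed.

(** * Invariance of V under generalised flows *)

Section Subspace.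
Variables (R : realType) (n : nat).
Implicit Types (X Y Z : vfield R n) (V : set (vfield R n)).

Lemma fd_subspaceD V X Y : fd_subspace V -> V X -> V Y -> V (X + Y).
Proof.
move=> [r [b ->]] [c ->] [d ->]; exists (fun i => c i + d i).
by rewrite -big_split; apply: eq_bigr => i _; rewrite scalerDl.
Qed.

Lemma fd_subspaceZ V k X : fd_subspace V -> V X -> V (k *: X).
Proof.
move=> [r [b ->]] [c ->]; exists (fun i => k * c i).
by rewrite scaler_sumr; apply: eq_bigr => i _; rewrite scalerA.
Qed.

Lemma fd_subspace0 V : fd_subspace V -> V 0.
Proof.
by move=> [r [b ->]]; exists (fun=> 0); rewrite big1// => i _; rewrite scale0r.
Qed.

Lemma fd_subspaceN V X : fd_subspace V -> V X -> V (- X).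
Proof. by move=> fV VX; rewrite -scaleN1r; exact: fd_subspaceZ. Qed.

Lemma fd_subspaceB V X Y : fd_subspace V -> V X -> V Y -> V (X - Y).
Proof. by move=> fV VX VY; apply: fd_subspaceD => //; exact: fd_subspaceN. Qed.

Lemma fd_subspace_sum V (I : Type) (r : seq I) (F : I -> vfield R n) :
  fd_subspace V -> (forall i, V (F i)) -> V (\sum_(i <- r) F i).
Proof.
move=> fV VF; elim/big_ind : _ => //; first exact: fd_subspace0.
by move=> X Y; exact: fd_subspaceD.
Qed.

Lemma bracketDr X Y Z : smooth X -> smooth Y -> smooth Z ->
  bracket X (Y + Z) = bracket X Y + bracket X Z.
Proof.
move=> sX sY sZ; apply/funext => x; rewrite /bracket.
have dY := smooth_differentiable x sY; have dZ := smooth_differentiable x sZ.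
have -> : 'D_(X x) (Y + Z) x = 'D_(X x) Y x + 'D_(X x) Z x.
  by apply: deriveD; exact: diff_derivable.
have -> : 'D_((Y + Z) x) X x = 'D_(Y x) X x + 'D_(Z x) X x.
  exact: deriveDir (smooth_differentiable x sX).
by rewrite [RHS]/GRing.add/= addrACA opprD.
Qed.

Lemma bracketZr X Y k : smooth X -> smooth Y ->
  bracket X (k *: Y) = k *: bracket X Y.
Proof.
move=> sX sY; apply/funext => x; rewrite /bracket.
have dY := smooth_differentiable x sY.
have -> : 'D_(X x) (k *: Y) x = k *: 'D_(X x) Y x.
  by apply: deriveZ; exact: diff_derivable.
have -> : 'D_((k *: Y) x) X x = k *: 'D_(Y x) X x.
  exact: deriveDirZ (smooth_differentiable x sX).
by rewrite [RHS]/GRing.scale/= scalerBr.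
Qed.

Lemma bracketC X Y : bracket X Y = - bracket Y X.
Proof. by apply/funext => x; rewrite [RHS]/GRing.opp/= /bracket opprB. Qed.

Lemma bracketxx X : bracket X X = 0.
Proof. by apply/funext => x; rewrite /bracket subrr. Qed.

Lemma bracketZl X Y k : smooth X -> smooth Y ->
  bracket (k *: X) Y = k *: bracket X Y.
Proof.
by move=> sX sY; rewrite bracketC (bracketZr _ sY sX) (bracketC X Y) scalerN.
Qed.

Lemma bracket0r X : smooth X -> bracket X 0 = 0.
Proof.
by move=> sX; rewrite -(scale0r X) (bracketZr 0 sX sX) !scale0r.
Qed.

Lemma bracketNr X Y : smooth X -> smooth Y -> bracket X (- Y) = - bracket X Y.
Proof. by move=> sX sY; rewrite -(scaleN1r Y) (bracketZr _ sX sY) scaleN1r. Qed.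

Lemma smoothN_vf X : smooth X -> smooth (- X).
Proof.
by move=> sX; rewrite -scaleN1r; apply: smoothZ => //; exact: smooth_cst.
Qed.

End Subspace.

Section PushforwardLinear.
Variables (R : realType) (n : nat).
Implicit Types (X Y : vfield R n) (g : diffeo R n).

Lemma pushforwardD g X Y : pushforward g (X + Y) = pushforward g X + pushforward g Y.
Proof.
apply/funext => x; apply: deriveDir.
exact: smooth_differentiable _ (dmap_smooth g).
Qed.

Lemma pushforwardZ g k X : pushforward g (k *: X) = k *: pushforward g X.
Proof.
apply/funext => x; apply: deriveDirZ.
exact: smooth_differentiable _ (dmap_smooth g).
Qed.

Lemma pushforward_sum g (I : Type) (r : seq I) (F : I -> vfield R n) :
  pushforward g (\sum_(i <- r) F i) = \sum_(i <- r) pushforward g (F i).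
Proof.
elim/big_rec2 : _ => [|i x y _ <-]; last exact: pushforwardD.
by rewrite -(scale0r (0 : vfield R n)) pushforwardZ !scale0r.
Qed.

Lemma pushforward_id g X : (forall x, g x = x) -> pushforward g X = X.
Proof.
move=> gE; apply/funext => x.
have ix : dinv g x = x by rewrite -[in LHS](gE x) dmapK.
rewrite /pushforward ix (_ : dmap g = id); last exact/funext.
exact: derive_id.
Qed.

Definition diffeoV g : diffeo R n :=
  Diffeo (@dinvK _ _ g) (@dmapK _ _ g) (@dinv_smooth _ _ g) (@dmap_smooth _ _ g).

Lemma pushforwardK g X : pushforward (diffeoV g) (pushforward g X) = X.
Proof.
apply/funext => x; rewrite [LHS]/pushforward /= /pushforward /= dmapK.
have dg := smooth_differentiable x (dmap_smooth g).
have di := smooth_differentiable (g x) (dinv_smooth g).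
have E := derive_comp (X x) dg di.
have gK : (fun y => dinv g (g y)) = id by apply/funext => y; exact: dmapK.
have E1 : 'D_(X x) (fun y => dinv g (g y)) x = X x.
  by rewrite gK; exact: derive_id.
by rewrite -[RHS]E1; exact: esym E.
Qed.

Lemma pushforwardVK g X : pushforward g (pushforward (diffeoV g) X) = X.
Proof.
have -> : g = diffeoV (diffeoV g) by case: g.
exact: pushforwardK.
Qed.

End PushforwardLinear.

Section Invariance.
Variables (R : realType) (n : nat) (W V : set (vfield R n)).
Hypothesis hS : quasi_lie_scheme W V.

Lemma is_derive_ev (X : R -> vfield R n) xi (t : R) : jsmooth X ->
  is_derive t 1 (fun s => ev xi (X s)) (ev xi (ddt X t)).
Proof.
move=> sX; have dX := @jsmooth_derivable1 _ _ X t xi.1 sX.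
have dc : derivable (fun s => ev xi (X s)) t 1.
  by have /derivable_mxP := dX; apply.
apply: (DeriveDef dc).
by rewrite /ev /ddt derive1E; exact: derive_coord dX.
Qed.

(** Obtained by differentiating the constant push-forward of the pull-back of [Z]. Pull-backs are
    preferred to push-forwards because here the bracket is taken with the fixed field [Z]: for [Z]
    in V it lies in V and can be expanded in a basis, which closes the system. For push-forwards it
    would involve the unknown field. *)
Lemma ddt_pullback (Y : R -> vfield R n) (g : R -> diffeo R n) (Z : vfield R n) s :
  jsmooth Y -> is_gflow Y g -> smooth Z ->
  ddt (fun s => pushforward (diffeoV (g s)) Z) s =
  pushforward (diffeoV (g s)) (bracket (Y s) Z).
Proof.
move=> sY [sg si _ gE] sZ; set Q := fun s => pushforward (diffeoV (g s)) Z.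
have sQ : jsmooth Q.
  apply: (@jsmooth_pushforward _ _ (fun s => diffeoV (g s)) (fun=> Z)) => //.
  exact: jsmooth_cst.
have QE r : pushforward (g r) (Q r) = Z by exact: pushforwardVK.
clearbody Q.
have E := @ddt_pushforward _ _ g Q Y s sg si sQ sY gE.
have E0 : ddt (fun t => pushforward (g t) (Q t)) s = 0.
  have -> : (fun t => pushforward (g t) (Q t)) = fun=> Z by exact/funext.
  by apply/funext => x; exact: derive1_cst.
rewrite -[LHS](pushforwardK (g s)); congr (pushforward _ _).
by rewrite E0 QE in E; apply/eqP; rewrite -subr_eq0 -E.
Qed.

(* The pull-backs of the basis of V solve a linear equation with values in V,
   hence remain in V. *)
Lemma pushforward_V (Y : R -> vfield R n) (g : R -> diffeo R n) t X :
  (forall t, W (Y t)) -> jsmooth Y -> is_gflow Y g -> V X ->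
  V (pushforward (g t) X).
Proof.
move=> WY sY [sg si g0 gE] VX.
have fV := qls_V_fd hS.
have [m [xi [lam [lamV dual repr]]]] := fd_subspace_dual fV.
pose Q k s := pushforward (diffeoV (g s)) (lam k).
have sQ k : jsmooth (Q k).
  apply: (@jsmooth_pushforward _ _ (fun s => diffeoV (g s)) (fun=> lam k)) => //.
  by apply: jsmooth_cst; exact: qls_smooth hS _ _.
pose A s k l := ev (xi l) (bracket (Y s) (lam k)).
have dQ k s : ddt (Q k) s = \sum_l A s k l *: Q l s.
  have [sl gf] : smooth (lam k) /\ is_gflow Y g.
    by split=> //; exact: qls_smooth hS _ _.
  rewrite [LHS](ddt_pullback s sY gf sl).
  have WV : V (bracket (Y s) (lam k)) by exact: (qls_brWV hS).
  rewrite (repr _ WV) pushforward_sum; apply: eq_bigr => l _.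
  by rewrite pushforwardZ.
have cA k l : continuous (fun s => A s k l).
  have sB : jsmooth (fun s => bracket (Y s) (lam k)).
    by apply: (@jsmooth_bracket _ _ Y (fun=> lam k)) => //;
      apply: jsmooth_cst; exact: qls_smooth hS _ _.
  move=> s; apply: differentiable_continuous; apply/derivable1_diffP.
  by have [] := is_derive_ev (xi l) s sB.
have Q0 k : Q k 0 = lam k.
  by apply: pushforward_id => x /=; rewrite -[in LHS](g0 x) dmapK.
have pQ k s : pushforward (g s) (Q k s) = lam k by exact: pushforwardVK.
clearbody Q.
have QE k s : Q k s = \sum_j ev (xi j) (Q k s) *: lam j.
  apply: evP => x; rewrite ev_sum; apply/eqP; rewrite -subr_eq0; apply/eqP.
  (* For fixed [x], the failure of [Q k s] to equal its expansion. It is linear in [Q k s], hence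
     solves the same system, and it vanishes at time 0, where [Q k] is a basis element. *)
  pose q k s := ev x (Q k s) - \sum_j ev x (ev (xi j) (Q k s) *: lam j).
  apply: (linear_ode_unique cA (q := q)) => {k s} [k s|k]; last first.
    rewrite /q Q0 -ev_sum -repr ?subrr//; exact: lamV.
  pose f j r := ev (xi j) (Q k r).
  have -> : q k = (fun s => ev x (Q k s)) - \sum_j (ev x (lam j) *: f j).
    apply/funext => r; rewrite /q [RHS]/GRing.add/= [in RHS]/GRing.opp/= fct_sumE.
    congr (_ - _); apply: eq_bigr => j _.
    by rewrite evZ mulrC.
  have dx := is_derive_ev x s (sQ k).
  have df j : is_derive s 1 (ev x (lam j) *: f j)
      (ev x (lam j) *: ev (xi j) (ddt (Q k) s)).
    exact: is_deriveZ (is_derive_ev (xi j) s (sQ k)).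
  apply: (is_derive_eq (is_deriveB dx (is_derive_sum df))).
  rewrite dQ ev_sum; under eq_bigr do rewrite evZ.
  under [X in _ - X]eq_bigr do rewrite ev_sum.
  rewrite /q; under [RHS]eq_bigr do rewrite mulrBr.
  rewrite sumrB; congr (_ - _).
  under [RHS]eq_bigr do rewrite mulr_sumr.
  rewrite exchange_big; apply: eq_bigr => j _.
  rewrite /GRing.scale/= mulr_sumr; apply: eq_bigr => l _.
  by rewrite !evZ mulrC mulrA.
(* So far the pull-backs of V lie in V; the claim needs them to fill V. [Phi] is the matrix of the
   pull-back in the basis [lam]. It has trivial kernel because the push-forward undoes the
   pull-back, so it is invertible and [X] is a combination of the [Q k t]. *)
pose Phi := \matrix_(k, j) ev (xi j) (Q k t).
have combE (v : 'rV[R]_m) : \sum_k v 0 k *: Q k t = \sum_j (v *m Phi) 0 j *: lam j.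
  under eq_bigr do rewrite QE scaler_sumr.
  rewrite exchange_big; apply: eq_bigr => j _; rewrite mxE scaler_suml.
  by apply: eq_bigr => k _; rewrite !mxE scalerA.
have pushQ v : pushforward (g t) (\sum_k v k *: Q k t) = \sum_k v k *: lam k.
  rewrite pushforward_sum; apply: eq_bigr => k _.
  by rewrite pushforwardZ pQ.
have uPhi : Phi \in unitmx.
  rewrite -row_free_unit; apply: inj_row_free => v v0; apply/rowP => j.
  have := combE v; rewrite v0 => /(congr1 (pushforward (g t))).
  rewrite pushQ [X in pushforward _ X]big1; last first.
    by move=> i _; rewrite mxE scale0r.
  rewrite -(scale0r (0 : vfield R n)) pushforwardZ !scale0r.
  move=> /(congr1 (ev (xi j))); rewrite ev_sum (bigD1 j)//= evZ dual eqxx mulr1.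
  rewrite big1 ?addr0; last by move=> i /negbTE ij; rewrite evZ dual ij mulr0.
  by move=> ->; rewrite /ev /= !mxE.
pose c : 'rV[R]_m := \row_k ev (xi k) X.
have := combE (c *m invmx Phi); rewrite mulmxKV//.
have -> : \sum_j c 0 j *: lam j = X.
  by rewrite [RHS](repr _ VX); apply: eq_bigr => j _; rewrite mxE.
move=> <-; rewrite pushQ; apply: fd_subspace_sum => // k.
exact: fd_subspaceZ.
Qed.

End Invariance.

(** * The second-order jet of the transformed curve *)

Section TimeDerivative.
Variables (R : realType) (n : nat).
Implicit Types (X Y Z : R -> vfield R n) (V : set (vfield R n)).

Lemma ddtD X Y t : jsmooth X -> jsmooth Y ->
  ddt (fun s => X s + Y s) t = ddt X t + ddt Y t.
Proof.
move=> sX sY; apply/funext => x.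
have dX := @jsmooth_derivable1 _ _ X t x sX.
have dY := @jsmooth_derivable1 _ _ Y t x sY.
by have E := deriveD dX dY; rewrite -!derive1E in E; exact: E.
Qed.

Lemma ddtB X Y t : jsmooth X -> jsmooth Y ->
  ddt (fun s => X s - Y s) t = ddt X t - ddt Y t.
Proof.
move=> sX sY; apply/funext => x.
have dX := @jsmooth_derivable1 _ _ X t x sX.
have dY := @jsmooth_derivable1 _ _ Y t x sY.
by have E := deriveB dX dY; rewrite -!derive1E in E; exact: E.
Qed.

Lemma jsmoothB X Y : jsmooth X -> jsmooth Y -> jsmooth (fun t => X t - Y t).
Proof.
move=> sX sY; apply: jsmoothD => //.
rewrite (_ : (fun t => - Y t) = fun t => (-1) *: Y t).
  by apply: (@jsmoothZ _ _ (fun=> -1)) => //; exact: smooth_cst.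
by apply/funext => t; rewrite scaleN1r.
Qed.

Lemma ddt_bracket X Y t : jsmooth X -> jsmooth Y ->
  ddt (fun s => bracket (X s) (Y s)) t =
  bracket (ddt X t) (Y t) + bracket (X t) (ddt Y t).
Proof.
move=> sX sY.
have sXY := jsmooth_derive sX sY; have sYX := jsmooth_derive sY sX.
rewrite [LHS](ddtB t sYX sXY); apply/funext => x.
have E1 := ddt_derive t x sX sY; have E2 := ddt_derive t x sY sX.
rewrite [LHS]/GRing.add/= [in LHS]/GRing.opp/= E1 E2.
have regroup (A : zmodType) (a b c d : A) : (a + b) - (c + d) = (b - c) + (a - d).
  by rewrite (addrC a) opprD addrACA.
exact: regroup.
Qed.

(** V is cut out by the equations saying that each value of a field equals the value of its
    expansion in [lam]. They are linear and involve finitely many evaluations each, so they survive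
    differentiation. *)
Lemma derivative_V V (X : R -> vfield R n) t : fd_subspace V ->
  (forall s, V (X s)) -> (forall x, derivable (fun s => X s x) t 1) ->
  V (ddt X t).
Proof.
move=> fV VX dX; have [m [xi [lam [lamV _ repr]]]] := fd_subspace_dual fV.
have dev xi0 : is_derive t 1 (fun s => ev xi0 (X s)) (ev xi0 (ddt X t)).
  have dc : derivable (fun s => ev xi0 (X s)) t 1.
    by have /derivable_mxP := dX xi0.1; apply.
  by apply: (DeriveDef dc); rewrite /ev /ddt derive1E; exact: derive_coord (dX xi0.1).
suff -> : ddt X t = \sum_k ev (xi k) (ddt X t) *: lam k.
  by apply: fd_subspace_sum => // k; exact: fd_subspaceZ.
apply: evP => x; rewrite ev_sum.
have dk k : is_derive t 1 (ev x (lam k) *: (fun s => ev (xi k) (X s)))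
    (ev x (lam k) *: ev (xi k) (ddt X t)) by exact: is_deriveZ (dev (xi k)).
have E : (fun s => ev x (X s)) =
    \sum_k (ev x (lam k) *: (fun s => ev (xi k) (X s))).
  apply/funext => s; rewrite {1}(repr _ (VX s)) ev_sum fct_sumE.
  by apply: eq_bigr => k _; rewrite evZ mulrC.
have [_ <-] := dev x.
rewrite E (@derive_val _ _ _ _ _ _ _ (is_derive_sum dk)).
by apply: eq_bigr => k _; rewrite evZ mulrC.
Qed.

Lemma tdep_ddt V X : fd_subspace V -> tdep V X -> tdep V (ddt X).
Proof.
move=> fV [VX sX]; split; last exact: jsmooth_ddt.
by move=> t; apply: derivative_V => // x; exact: jsmooth_derivable1.
Qed.

Lemma derive1_scale (k : R -> R) (f : R -> 'rV[R]_n) (t : R) :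
  derivable k t 1 -> derivable f t 1 ->
  derive1 (fun s => k s *: f s) t = derive1 k t *: f t + k t *: derive1 f t.
Proof.
move=> dk df; have dfj j : derivable (fun s => f s 0 j) t 1.
  by have /derivable_mxP := df; apply.
have dkf : derivable (fun s => k s *: f s) t 1.
  apply/derivable_mxP => i j; rewrite ord1.
  have -> : (fun s => (k s *: f s) 0 j) = k * (fun s => f s 0 j).
    by apply/funext => s; rewrite mxE.
  exact: derivableM dk (dfj j).
apply/rowP => j; rewrite !derive1E -(derive_coord 0 j dkf).
have -> : (fun s => (k s *: f s) 0 j) = k * (fun s => f s 0 j).
  by apply/funext => s; rewrite mxE.
rewrite (deriveM dk (dfj j)) (derive_coord 0 j df) !mxE addrC.
by rewrite /GRing.scale/= mulrC; congr (_ + _); rewrite mulrC.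
Qed.

End TimeDerivative.

Section JetAlgebra.
Variables (R : realType) (n : nat).
Implicit Types (X Y : vfield R n).

Lemma smooth_bracket X Y : smooth X -> smooth Y -> smooth (bracket X Y).
Proof.
move=> sX sY.
exact: smooth_jsmooth 0 (jsmooth_bracket (jsmooth_cst sX) (jsmooth_cst sY)).
Qed.

Lemma smoothD_vf X Y : smooth X -> smooth Y -> smooth (X + Y).
Proof. exact: smoothD. Qed.

Lemma smoothZ_vf k X : smooth X -> smooth (k *: X).
Proof. by move=> sX; apply: smoothZ => //; exact: smooth_cst. Qed.

(** Here [y0], [y1], [y2] stand for Y, Y', Y'' and [p0], [p1], [p2] for the push-forwards of X, X',
    X''. T_2 acts after T_1 has changed the first entry to p0 + y0, so it creates an unwanted - a
    [a y1, y0]; the last term of its parameter cancels it. *)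
Lemma jet_algebra (a b : R) (y0 y1 y2 p0 p1 p2 : vfield R n) :
  smooth y0 -> smooth y1 -> smooth p0 -> smooth p1 ->
  (y0 + p0,
   a *: (y1 + (p1 - bracket y0 p0)),
   b *: (y1 + (p1 - bracket y0 p0)) + a ^+ 2 *:
     (y2 + ((p2 - bracket y0 p1) -
            (bracket y1 p0 + bracket y0 (p1 - bracket y0 p0))))) =
  actT2_0 a (0, a *: y1, b *: y1 + a ^+ 2 *: y2 + a *: bracket (a *: y1) y0)
    (flowT1 a b y0 1 (p0, a *: p1, b *: p1 + a ^+ 2 *: p2)).
Proof.
move=> sy0 sy1 sp0 sp1; have sb := smooth_bracket sy0 sp0.
rewrite /actT2_0 /flowT1 /=.
rewrite (bracketDr sy0 sp1 (smoothN_vf sb)) (bracketNr sy0 sb).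
rewrite (bracketZl a sy1 sy0) (bracketZr a sy0 sp1).
rewrite (bracketZl a sy1 (smoothD_vf sp0 (smoothZ_vf 1 sy0))).
rewrite (bracketDr sy1 sp0 (smoothZ_vf 1 sy0)) (bracketZr 1 sy1 sy0).
(* Once bilinearity has been used up, the brackets are opaque atoms, and evaluation at a point
   leaves a polynomial identity between real numbers. *)
move: {sb} (bracket y0 (bracket y0 p0)) (bracket y0 p0) (bracket y0 p1)
  (bracket y1 p0) (bracket y1 y0) => b000 b00 b01 b10 c10.
congr (_, _, _); apply: evP => xi; rewrite !(evD, evZ, evN); move: (ev xi) => e.
- by rewrite mul1r addrC.
- by move: (e y1) (e p1) (e b00) => *; ring.
- by move: (e y1) (e p1) (e b00) (e y2) (e p2) (e b01) (e b10) (e b000) (e c10) => *;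
    ring.
Qed.

End JetAlgebra.

Section Jets.
Variables (R : realType) (n : nat) (W V : set (vfield R n)) (tbar : R -> R).
Hypothesis hS : quasi_lie_scheme W V.
Hypothesis htbar : is_parameter tbar.

Let fW := qls_W_fd hS.
Let fV := qls_V_fd hS.

Lemma dt_dtbarE t : dt_dtbar tbar t = (derive1 tbar t)^-1.
Proof. by rewrite /dt_dtbar /dpar derive1_id [LHS]mulr1. Qed.

Lemma derivable_dt_dtbar t : derivable (dt_dtbar tbar) t 1.
Proof.
have [stbar ntbar] := htbar.
pose T (s : R) : R := derive1 tbar s.
have -> : dt_dtbar tbar = fun s => (T s)^-1 by apply/funext => s; exact: dt_dtbarE.
apply: derivableV; first exact: ntbar.
apply: diff_derivable.
have -> : T = (fun s => 'D_1 tbar s) by apply/funext => s; rewrite /T derive1E.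
exact: smooth_differentiable _ (smooth_derive (1 : R) stbar).
Qed.

Lemma dt_dtbar_neq0 t : dt_dtbar tbar t != 0.
Proof. by rewrite dt_dtbarE invr_eq0; case: htbar. Qed.

(** With a = dt/dtbar, applying a d/dt twice gives a a' X' + a^2 X'', and a a' is the second
    derivative of t with respect to tbar. *)
Lemma jet2E (X : R -> vfield R n) t : jsmooth X -> jet2 tbar X t =
  (X t, dt_dtbar tbar t *: ddt X t,
   d2t_dtbar2 tbar t *: ddt X t + dt_dtbar tbar t ^+ 2 *: ddt (ddt X) t).
Proof.
move=> sX; have E s : dpar_vf tbar X s = dt_dtbar tbar s *: ddt X s.
  by apply/funext => x; rewrite /dpar_vf /dpar -dt_dtbarE.
rewrite /jet2; congr (_, _, _); first exact: E.
apply/funext => x; rewrite /dpar_vf /dpar -dt_dtbarE.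
have -> : (fun s => (derive1 tbar s)^-1 *: derive1 (fun s0 => X s0 x) s) =
          (fun s => dt_dtbar tbar s *: ddt X s x).
  by apply/funext => s; rewrite dt_dtbarE.
rewrite derive1_scale; last exact: jsmooth_derivable1 (jsmooth_ddt sX).
- rewrite scalerDr scalerA [RHS]/GRing.add/= [in RHS]/GRing.scale/=.
  by rewrite scalerA -expr2 /d2t_dtbar2 /dpar -dt_dtbarE.
- exact: derivable_dt_dtbar.
Qed.

Lemma gflow_actE Y (g : R -> diffeo R n) X : is_gflow Y g ->
  gflow_act g X = fun t => Y t + pushforward (g t) (X t).
Proof.
move=> [_ _ _ gE]; apply/funext => t; apply/funext => x.
by rewrite /gflow_act gE Defs.dinvK.
Qed.

Lemma tdep_pushforward Y g X : tdep W Y -> is_gflow Y g -> tdep V X ->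
  tdep V (fun t => pushforward (g t) (X t)).
Proof.
move=> [WY sY] gf [VX sX]; split; last first.
  by have [sg si _ _] := gf; exact: jsmooth_pushforward.
by move=> t; exact: (@pushforward_V _ _ W V hS Y g t (X t)) (VX t).
Qed.

Lemma tdep_gflow_act Y g X : tdep W Y -> is_gflow Y g -> tdep V X ->
  tdep V (gflow_act g X).
Proof.
move=> tY gf tX; rewrite (gflow_actE X gf).
have [VP sP] := tdep_pushforward tY gf tX; have [WY sY] := tY.
split; last exact: (@jsmoothD _ _ Y (fun t => pushforward (g t) (X t)) sY sP).
by move=> t; apply: fd_subspaceD => //; exact: qls_WV hS _ (WY t).
Qed.

Lemma jet2_gflow_act Y g X t : tdep W Y -> is_gflow Y g -> tdep V X ->
  jet2 tbar (gflow_act g X) t =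
  actT2_0 (dt_dtbar tbar t)
    (0, dt_dtbar tbar t *: ddt Y t,
     d2t_dtbar2 tbar t *: ddt Y t + dt_dtbar tbar t ^+ 2 *: ddt (ddt Y) t +
     dt_dtbar tbar t *: bracket (dt_dtbar tbar t *: ddt Y t) (Y t))
    (flowT1 (dt_dtbar tbar t) (d2t_dtbar2 tbar t) (Y t) 1
       (actJ2 (g t) (jet2 tbar X t))).
Proof.
move=> tY gf tX; have [WY sY] := tY; have [VX sX] := tX.
have [_ sZ] := tdep_gflow_act tY gf tX.
have [sg si _ gE] := gf.
have sX1 := jsmooth_ddt sX; have sY1 := jsmooth_ddt sY.
(* The push-forwards of all time derivatives of X are treated together: [dP] expresses the
   derivative of each through the next one, and nothing else about the flow enters the computation
   of the jet. *)
pose P k s := pushforward (g s) (iter k (@ddt R n) X s).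
have sI k : jsmooth (iter k (@ddt R n) X).
  by elim: k => [|k IH]; [exact: sX|exact: jsmooth_ddt IH].
have sP k : jsmooth (P k) by exact: jsmooth_pushforward sg si (sI k).
have dP k s : ddt (P k) s = P k.+1 s - bracket (Y s) (P k s).
  exact: ddt_pushforward sg si (sI k) sY gE.
have ZE : gflow_act g X = fun s => Y s + P 0 s by exact: gflow_actE.
have aJ : actJ2 (g t) (jet2 tbar X t) = (P 0 t, dt_dtbar tbar t *: P 1 t,
    d2t_dtbar2 tbar t *: P 1 t + dt_dtbar tbar t ^+ 2 *: P 2 t).
  by rewrite (jet2E t sX) /actJ2 /= pushforwardD !pushforwardZ.
clearbody P.
rewrite aJ (jet2E t sZ) ZE.
have sB k : jsmooth (fun s => bracket (Y s) (P k s)) by exact: jsmooth_bracket.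
have dZ s : ddt (fun s => Y s + P 0 s) s =
    ddt Y s + (P 1 s - bracket (Y s) (P 0 s)).
  by rewrite (ddtD s sY (sP 0)) dP.
have ddZ : ddt (ddt (fun s => Y s + P 0 s)) t = ddt (ddt Y) t +
    ((P 2 t - bracket (Y t) (P 1 t)) -
     (bracket (ddt Y t) (P 0 t) + bracket (Y t) (P 1 t - bracket (Y t) (P 0 t)))).
  have -> : ddt (fun s => Y s + P 0 s) =
      fun s => ddt Y s + (P 1 s - bracket (Y s) (P 0 s)) by exact/funext.
  rewrite (ddtD t sY1 (jsmoothB (sP 1) (sB 0))) (ddtB t (sP 1) (sB 0)).
  by rewrite (ddt_bracket t sY (sP 0)) !dP.
rewrite dZ ddZ; apply: jet_algebra; exact: smooth_jsmooth.
Qed.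

End Jets.

(** * First integrals on the space of jets *)

Section FirstIntegrals.
Variables (R : realType) (n : nat) (V : set (vfield R n)) (phi : triple R n -> R).
Hypothesis fV : fd_subspace V.
Hypothesis hphi : smooth_on_T2 V phi.

(** Pointwise on R^n, to match [generator]; for curves in T^2 V it gives differentiability of the
    coordinates, as [chain_T2] shows. *)
Definition pderivable (P : R -> triple R n) (t : R) : Prop := forall x,
  [/\ derivable (fun s => (P s).1.1 x) t 1, derivable (fun s => (P s).1.2 x) t 1 &
      derivable (fun s => (P s).2 x) t 1].

Definition velocity (P : R -> triple R n) (t : R) : triple R n :=
  (ddt (fun s => (P s).1.1) t, ddt (fun s => (P s).1.2) t, ddt (fun s => (P s).2) t).

(** In coordinates of V the function [phi] becomes a smooth [psi]. The derivative along the curve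
    and the derivative along its tangent line are then both the derivative of [psi] in the direction
    of the coordinate velocity. *)
Lemma chain_T2 (P : R -> triple R n) (t : R) :
  (forall s, T2 V (P s)) -> pderivable P t ->
  is_derive t 1 (fun s => phi (P s))
    (derive1 (fun h : R => phi (P t + h *: velocity P t)) 0).
Proof.
move=> VP dP; have [m [xi [lam [lamV _ repr]]]] := fd_subspace_dual fV.
pose psi (c : 'rV[R]_m * 'rV[R]_m * 'rV[R]_m) :=
  phi (\sum_(i < m) c.1.1 0 i *: lam i, \sum_(i < m) c.1.2 0 i *: lam i,
       \sum_(i < m) c.2 0 i *: lam i).
have spsi : smooth psi by exact: hphi.
pose co (X : vfield R n) : 'rV[R]_m := \row_k ev (xi k) X.
pose co3 (p : triple R n) := (co p.1.1, co p.1.2, co p.2).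
have phiE p : T2 V p -> phi p = psi (co3 p).
  move: p => [[p0 p1] p2] [/= V0 V1 V2]; rewrite /psi /co3 /=; congr (phi (_, _, _)).
  - by rewrite {1}(repr _ V0); apply: eq_bigr => k _; rewrite mxE.
  - by rewrite {1}(repr _ V1); apply: eq_bigr => k _; rewrite mxE.
  - by rewrite {1}(repr _ V2); apply: eq_bigr => k _; rewrite mxE.
have dco (X : R -> vfield R n) : (forall x, derivable (fun s => X s x) t 1) ->
    differentiable (fun s => co (X s)) t /\
    'D_1 (fun s => co (X s)) t = co (ddt X t).
  move=> dX.
  have dj k : derivable (fun s => ev (xi k) (X s)) t 1.
    by have /derivable_mxP := dX (xi k).1; apply.
  have dC : derivable (fun s => co (X s)) t 1.
    apply/derivable_mxP => i k.
    by under eq_fun do rewrite mxE; exact: dj.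
  split; first exact/derivable1_diffP.
  apply/rowP => k; rewrite -(derive_coord 0 k dC) mxE.
  have -> : (fun s => co (X s) 0 k) = (fun s => ev (xi k) (X s)).
    by apply/funext => s; rewrite mxE.
  by rewrite /ev /ddt derive1E; exact: derive_coord (dX _).
have VP0 s : V (P s).1.1 by case: (VP s).
have VP1 s : V (P s).1.2 by case: (VP s).
have VP2 s : V (P s).2 by case: (VP s).
have d0 x : derivable (fun s => (P s).1.1 x) t 1 by case: (dP x).
have d1 x : derivable (fun s => (P s).1.2 x) t 1 by case: (dP x).
have d2 x : derivable (fun s => (P s).2 x) t 1 by case: (dP x).
have [dc0 Dc0] := dco _ d0; have [dc1 Dc1] := dco _ d1; have [dc2 Dc2] := dco _ d2.
pose C s := co3 (P s).
have dC : differentiable C t.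
  by apply: differentiable_pair => //; exact: differentiable_pair.
have DC : 'D_1 C t = co3 (velocity P t).
  rewrite (derive_pair (1 : R) (differentiable_pair dc0 dc1) dc2).
  by rewrite (derive_pair (1 : R) dc0 dc1) Dc0 Dc1 Dc2.
have dpsi c : differentiable psi c by exact: smooth_differentiable.
have VQ : T2 V (velocity P t).
  by split; apply: derivative_V.
have lin h : phi (P t + h *: velocity P t) = psi (C t + h *: co3 (velocity P t)).
  rewrite phiE.
    congr psi; rewrite /C /co3 /=; congr (_, _, _); apply/rowP => k;
      rewrite !mxE; exact: etrans (evD _ _ _) (congr1 _ (evZ _ _ _)).
  case: (VP t) VQ => [V0 V1 V2] [Q0 Q1 Q2].
  by split; apply: fd_subspaceD => //; apply: fd_subspaceZ.
have E : (fun s => phi (P s)) = (fun s => psi (C s)).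
  by apply/funext => s; exact: phiE.
have dE : derivable (fun s => psi (C s)) t 1.
  by apply: diff_derivable; exact: (differentiable_comp dC (dpsi _)).
rewrite E; apply: (DeriveDef dE).
have -> : (fun h => phi (P t + h *: velocity P t)) =
          (fun h => psi (C t + h *: co3 (velocity P t))) by exact/funext.
have [_ D] := is_derive_along (dpsi (C t + 0 *: co3 (velocity P t))).
rewrite derive1E D scale0r addr0 -DC.
exact: derive_comp dC (dpsi _).
Qed.

Lemma first_integral_of_invariant (Phi : R -> triple R n -> triple R n) :
  (forall p, T2 V p -> Phi 0 p = p) ->
  (forall s p, T2 V p -> T2 V (Phi s p)) ->
  (forall p, T2 V p -> pderivable (Phi^~ p) 0) ->
  (forall s p, T2 V p -> phi (Phi s p) = phi p) ->
  first_integral V (generator Phi) phi.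
Proof.
move=> Phi0 VPhi dPhi inv p Vp.
have := chain_T2 (fun s => VPhi s p Vp) (dPhi p Vp).
rewrite (Phi0 _ Vp) (_ : (fun s => phi (Phi s p)) = cst (phi p)); last first.
  by apply/funext => s; exact: inv.
by case=> _; rewrite derive_cst => <-.
Qed.

(** The field [A] may change with the time: this covers generalised flows, whose generator is
    time-dependent, as well as one-parameter groups. *)
Lemma constant_of_first_integral (P : R -> triple R n) :
  (forall s, T2 V (P s)) -> (forall t, pderivable P t) ->
  (forall t, exists2 A, first_integral V A phi & velocity P t = A (P t)) ->
  forall t, phi (P t) = phi (P 0).
Proof.
move=> VP dP HA t; apply: (@is_derive_0_is_cst _ (fun s => phi (P s))) => s.
have := chain_T2 VP (dP s).
by have [A hA ->] := HA s; rewrite (hA _ (VP s)).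
Qed.

(** The hypothesis on velocities is the group law in infinitesimal form: at each time the orbit
    moves along the generator at its current point. *)
Lemma invariant_of_first_integral (Phi : R -> triple R n -> triple R n) p t :
  (forall s p, T2 V p -> T2 V (Phi s p)) ->
  (forall t p, T2 V p -> pderivable (Phi^~ p) t) ->
  (forall s p, T2 V p -> velocity (Phi^~ p) s = generator Phi (Phi s p)) ->
  first_integral V (generator Phi) phi ->
  T2 V p -> Phi 0 p = p -> phi (Phi t p) = phi p.
Proof.
move=> VPhi dPhi flow hA Vp Phi0; rewrite -[in RHS]Phi0.
apply: (@constant_of_first_integral (Phi^~ p)) => [s|s|s].
- exact: VPhi.
- exact: dPhi.
- by exists (generator Phi); [exact: hA|exact: flow].
Qed.

End FirstIntegrals.

(** * Curves of jets that are quadratic in the parameter *)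

Section QuadraticCurves.
Variables (R : realType) (n : nat).
Implicit Types (X : vfield R n) (P : R -> vfield R n).

Lemma is_derive_quadratic P c0 c1 c2 (t : R) x :
  (forall s, P s = c0 + s *: c1 + s ^+ 2 *: c2) ->
  is_derive t 1 (fun s => P s x) (c1 x + (2 * t) *: c2 x).
Proof.
move=> PE; have dl : derivable (fun s : R => s) t 1 by exact: derivable_id.
have dq : derivable (fun s : R => s ^+ 2) t 1 by exact: exprn_derivable.
have dc (c : 'rV[R]_n) : derivable (fun _ : R => c) t 1 by exact: derivable_cst.
have dz (k : R -> R) (c : 'rV[R]_n) : derivable k t 1 ->
    is_derive t 1 (fun s => k s *: c) (derive1 k t *: c).
  move=> dk; have dkc : derivable (fun s => k s *: c) t 1.
    by apply: diff_derivable; apply: differentiableZl; exact/derivable1_diffP.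
  apply: (DeriveDef dkc).
  by rewrite -derive1E (derive1_scale dk (dc c)) derive1_cst scaler0 addr0.
have -> : (fun s => P s x) =
    cst (c0 x) + (fun s => s *: c1 x) + (fun s => s ^+ 2 *: c2 x).
  by apply/funext => s; rewrite PE.
apply: (is_derive_eq (is_deriveD (is_deriveD (is_derive_cst _ _ _) (dz _ (c1 x) dl))
  (dz _ (c2 x) dq))).
by rewrite derive1_id scale1r exp_derive1 add0r expr1.
Qed.

Lemma ddt_quadratic P c0 c1 c2 t :
  (forall s, P s = c0 + s *: c1 + s ^+ 2 *: c2) ->
  ddt P t = c1 + (2 * t) *: c2.
Proof.
move=> PE; apply/funext => x; rewrite /ddt derive1E.
by have [_ ->] := is_derive_quadratic t x PE.
Qed.

Lemma pderivable_quadratic (P : R -> triple R n) (c0 c1 c2 : triple R n) t :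
  (forall s, P s = c0 + s *: c1 + s ^+ 2 *: c2) -> pderivable P t.
Proof.
move=> PE x; split.
- by have [] := @is_derive_quadratic (fun s => (P s).1.1) c0.1.1 c1.1.1 c2.1.1 t x
    (fun s => congr1 (fun p : triple R n => p.1.1) (PE s)).
- by have [] := @is_derive_quadratic (fun s => (P s).1.2) c0.1.2 c1.1.2 c2.1.2 t x
    (fun s => congr1 (fun p : triple R n => p.1.2) (PE s)).
- by have [] := @is_derive_quadratic (fun s => (P s).2) c0.2 c1.2 c2.2 t x
    (fun s => congr1 (fun p : triple R n => p.2) (PE s)).
Qed.

Lemma velocity_quadratic (P : R -> triple R n) (c0 c1 c2 : triple R n) t :
  (forall s, P s = c0 + s *: c1 + s ^+ 2 *: c2) ->
  velocity P t = c1 + (2 * t) *: c2.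
Proof.
move=> PE; rewrite /velocity.
rewrite (@ddt_quadratic (fun s => (P s).1.1) c0.1.1 c1.1.1 c2.1.1 t
    (fun s => congr1 (fun p : triple R n => p.1.1) (PE s))).
rewrite (@ddt_quadratic (fun s => (P s).1.2) c0.1.2 c1.1.2 c2.1.2 t
    (fun s => congr1 (fun p : triple R n => p.1.2) (PE s))).
by rewrite (@ddt_quadratic (fun s => (P s).2) c0.2 c1.2 c2.2 t
    (fun s => congr1 (fun p : triple R n => p.2) (PE s))).
Qed.

Lemma velocity_quadratic0 (P : R -> triple R n) (c0 c1 c2 : triple R n) :
  (forall s, P s = c0 + s *: c1 + s ^+ 2 *: c2) -> velocity P 0 = c1.
Proof.
by move=> PE; rewrite (velocity_quadratic 0 PE) mulr0 scale0r addr0.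
Qed.

End QuadraticCurves.

(** * The motions by T^2, T_1 and T_2 as quadratic curves in T^2 V *)

Section Flows.
Variables (R : realType) (n : nat) (W V : set (vfield R n)).
Hypothesis hS : quasi_lie_scheme W V.

Let fW := qls_W_fd hS.
Let fV := qls_V_fd hS.

Lemma flowT1_quadratic a b L (p : triple R n) s :
  flowT1 a b L s p = p
    + s *: (L, - (a *: bracket L p.1.1),
            - ((2 * a) *: bracket L p.1.2) - b *: bracket L p.1.1)
    + s ^+ 2 *: (0, 0, a ^+ 2 *: bracket L (bracket L p.1.1)).
Proof.
case: p => [[X Y] Z]; rewrite /flowT1 /=.
move: (bracket L (bracket L X)) (bracket L X) (bracket L Y) => B2 B1 BY.
congr (_, _, _); apply: evP => xi; rewrite /= !(evD, evZ, evN, ev0);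
  move: (ev xi) => e.
- by move: (e X) (e L) => *; ring.
- by move: (e Y) (e B1) => *; ring.
- by move: (e Z) (e B1) (e B2) (e BY) => *; ring.
Qed.

Lemma actT2_0_quadratic a (q p : triple R n) s :
  smooth q.1.2 -> smooth p.1.1 ->
  actT2_0 a (s *: q) p = p
    + s *: (0, q.1.2, q.2 - a *: bracket q.1.2 p.1.1) + s ^+ 2 *: 0.
Proof.
case: q p => [[L0 L1] L2] [[X Y] Z] /= sL sX; rewrite /actT2_0 /=.
rewrite (bracketZl s sL sX); move: (bracket L1 X) => B1.
congr (_, _, _); apply: evP => xi; rewrite /= !(evD, evZ, evN, ev0);
  move: (ev xi) => e.
- by move: (e X) => *; ring.
- by move: (e Y) (e L1) => *; ring.
- by move: (e Z) (e B1) (e L2) => *; ring.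
Qed.

Lemma actT2_quadratic (q p : triple R n) s :
  actT2 (s *: q) p = p + s *: q + s ^+ 2 *: 0.
Proof. by rewrite /actT2 scaler0 addr0. Qed.

Lemma T2_smooth p : T2 V p -> [/\ smooth p.1.1, smooth p.1.2 & smooth p.2].
Proof. by case=> V0 V1 V2; split; exact: qls_smooth hS _ _. Qed.

Lemma W_smooth L : W L -> smooth L.
Proof. by move=> WL; exact: qls_smooth hS _ (qls_WV hS WL). Qed.

Lemma T2D p q : T2 V p -> T2 V q -> T2 V (p + q).
Proof. by case=> V0 V1 V2 [U0 U1 U2]; split; apply: fd_subspaceD. Qed.

Lemma T2Z k p : T2 V p -> T2 V (k *: p).
Proof. by case=> V0 V1 V2; split; apply: fd_subspaceZ. Qed.

Lemma T2_flowT1 a b L s p : W L -> T2 V p -> T2 V (flowT1 a b L s p).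
Proof.
move=> WL Vp; have [V0 V1 V2] := Vp; rewrite flowT1_quadratic.
have VB X : V X -> V (bracket L X) by exact: (qls_brWV hS).
apply: T2D; [apply: T2D => //|]; apply: T2Z; split => /=.
- exact: qls_WV hS _ WL.
- by apply: fd_subspaceN => //; apply: fd_subspaceZ => //; exact: VB.
- apply: fd_subspaceB => //; first apply: fd_subspaceN => //.
    by apply: fd_subspaceZ => //; exact: VB.
  by apply: fd_subspaceZ => //; exact: VB.
- exact: fd_subspace0.
- exact: fd_subspace0.
- by apply: fd_subspaceZ => //; exact: (VB _ (VB _ V0)).
Qed.

Lemma T2_actT2_0 a q s p : T2_0 W q -> T2 V p -> T2 V (actT2_0 a (s *: q) p).
Proof.
move=> [[W0 W1 W2] q0] Vp; have [V0 V1 V2] := Vp.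
have [s0 _ _] := T2_smooth Vp.
rewrite (actT2_0_quadratic a s (W_smooth W1) s0) scaler0 addr0.
apply: T2D => //; apply: T2Z; split => /=.
- exact: fd_subspace0.
- exact: qls_WV hS _ W1.
- apply: fd_subspaceB => //; first exact: qls_WV hS _ W2.
  by apply: fd_subspaceZ => //; exact: (qls_brWV hS).
Qed.

(** The flow property rests on [L, X + s L] = [L, X], while [L, Y - s a [L, X]] in the third entry
    accounts for the derivative of the term in s^2. *)
Lemma velocity_flowT1 a b L s p : W L -> T2 V p ->
  velocity (fun r => flowT1 a b L r p) s = generator (flowT1 a b L) (flowT1 a b L s p).
Proof.
move=> WL Vp; have [s0 s1 s2] := T2_smooth Vp; have sL := W_smooth WL.
have sB := smooth_bracket sL s0.
rewrite (velocity_quadratic s (fun r => flowT1_quadratic a b L p r)).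
rewrite [RHS](velocity_quadratic0 (fun r => flowT1_quadratic a b L _ r)).
have -> : (flowT1 a b L s p).1.1 = p.1.1 + s *: L by case: p {Vp s0 s1 s2 sB} => [[]].
have -> : (flowT1 a b L s p).1.2 = p.1.2 - (s * a) *: bracket L p.1.1.
  by case: p {Vp s0 s1 s2 sB} => [[]].
rewrite (bracketDr sL s0 (smoothZ_vf s sL)) (bracketZr s sL sL) bracketxx.
rewrite scaler0 addr0.
rewrite (bracketDr sL s1 (smoothN_vf (smoothZ_vf (s * a) sB))).
rewrite (bracketNr sL (smoothZ_vf (s * a) sB)) (bracketZr (s * a) sL sB).
move: {sB} (bracket L (bracket L p.1.1)) (bracket L p.1.1) (bracket L p.1.2)
  => B2 B1 BY.
congr (_, _, _); apply: evP => xi; rewrite /= !(evD, evZ, evN, ev0);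
  move: (ev xi) => e.
- by move: (e L) => *; ring.
- by move: (e B1) => *; ring.
- by move: (e B1) (e B2) (e BY) => *; ring.
Qed.

(** The first entry of the jet does not move, so the bracket in the third entry is the same at all
    times and the curve is affine. *)
Lemma velocity_actT2_0 a q s p : T2_0 W q -> T2 V p ->
  velocity (fun r => actT2_0 a (r *: q) p) s =
  generator (fun r => actT2_0 a (r *: q)) (actT2_0 a (s *: q) p).
Proof.
move=> Wq Vp; have [[W0 W1 W2] q0] := Wq.
have [s0 _ _] := T2_smooth Vp.
have [t0 _ _] := T2_smooth (T2_actT2_0 a s Wq Vp).
rewrite (velocity_quadratic s (fun r => actT2_0_quadratic a r (W_smooth W1) s0)).
rewrite [RHS](velocity_quadratic0 (fun r => actT2_0_quadratic a r (W_smooth W1) t0)).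
rewrite scaler0 addr0; congr (_, _, _ - _ *: bracket _ _).
Qed.

End Flows.

(** * Curves with prescribed jets *)

Section Quartic.
Variable R : realType.
Implicit Types (t u c : R).

Definition quartic u c0 c1 c2 c3 c4 t : R :=
  c0 + c1 * (t - u) + c2 * (t - u) ^+ 2 + c3 * (t - u) ^+ 3 + c4 * (t - u) ^+ 4.

Lemma smooth_quartic u c0 c1 c2 c3 c4 : smooth (quartic u c0 c1 c2 c3 c4).
Proof.
have su : smooth (fun t : R => t - u).
  by apply: smoothD; [exact: smooth_id|exact: smooth_cst].
have sm c k : smooth (fun t : R => c * (t - u) ^+ k).
  by apply: smoothM; [exact: smooth_cst|exact: smoothX].
have sc c : smooth (fun _ : R => c) by exact: smooth_cst.
exact: smoothD (smoothD (smoothD (smoothD (sc c0) (smoothM (sc c1) su)) (sm c2 2))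
  (sm c3 3)) (sm c4 4).
Qed.

Lemma derive1_quartic u c0 c1 c2 c3 c4 :
  derive1 (quartic u c0 c1 c2 c3 c4) =
  quartic u c1 (2 * c2) (3 * c3) (4 * c4) 0.
Proof.
apply/funext => t; rewrite derive1E.
have du : is_derive t 1 (fun s : R => s - u) 1.
  by apply: is_derive_eq; rewrite subr0.
have dp k : is_derive t 1 (fun s : R => (s - u) ^+ k.+1) (k.+1%:R * (t - u) ^+ k).
  have -> : (fun s : R => (s - u) ^+ k.+1) = (fun s => s - u) ^+ k.+1.
    by apply/funext => s; rewrite exprfctE.
  by apply: (is_derive_eq (is_deriveX k.+1 du)); exact: mulr1.
have dm c k : is_derive t 1 (fun s : R => c * (s - u) ^+ k.+1)
    (c * (k.+1%:R * (t - u) ^+ k)).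
  exact: is_deriveZ (dp k).
have dc : is_derive t 1 (cst c0) 0 by exact: is_derive_cst.
have d1 : is_derive t 1 (fun s => c1 * (s - u)) (c1 * 1) by exact: is_deriveZ du.
have [_ E] := is_deriveD (is_deriveD (is_deriveD (is_deriveD dc d1) (dm c2 1))
  (dm c3 2)) (dm c4 3).
by rewrite [LHS]E /quartic; ring.
Qed.

Lemma quarticxx u c0 c1 c2 c3 c4 : quartic u c0 c1 c2 c3 c4 u = c0.
Proof. by rewrite /quartic subrr !expr0n /=; ring. Qed.

(** The condition at 0 makes exp(f(t) L) start at the identity. Three derivatives are prescribed
    because this flow is generated by f' L, whose jet of order two is needed. *)
Lemma hermite_interpolation u a0 a1 a2 a3 : (u = 0 -> a0 = 0) ->
  exists f : R -> R, [/\ smooth f, f 0 = 0, f u = a0 &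
    [/\ derive1 f u = a1, derive1 (derive1 f) u = a2 &
        derive1 (derive1 (derive1 f)) u = a3]].
Proof.
(* The cubic Taylor polynomial at [u] meets all conditions except the one at 0, where its value is
   [r]. The term of degree four removes [r] without touching the jet of order three at [u]; if u =
   0, the condition at 0 is just a0 = 0. *)
move=> u0; pose r := quartic u a0 a1 (a2 / 2) (a3 / 6) 0 0.
exists (quartic u a0 a1 (a2 / 2) (a3 / 6) (- r / u ^+ 4)); split.
- exact: smooth_quartic.
- have [u_eq0|u_neq0] := eqVneq u 0.
    rewrite u_eq0 quarticxx; exact: u0.
  by rewrite {1}/quartic /r /quartic; field.
- exact: quarticxx.
- rewrite !derive1_quartic !quarticxx; split => //; by field.
Qed.

End Quartic.

Section Curves.
Variables (R : realType) (n : nat).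
Implicit Types (X : vfield R n).

Lemma ddt_scale (f : R -> R) (X : vfield R n) t : smooth f ->
  ddt (fun s => f s *: X) t = derive1 f t *: X.
Proof.
move=> sf; apply/funext => x; rewrite /ddt.
have df : derivable f t 1 by apply: diff_derivable; exact: smooth_differentiable.
have dX : derivable (fun _ : R => X x) t 1 by exact: derivable_cst.
rewrite (derive1_scale df dX).
by rewrite derive1_cst scaler0 addr0.
Qed.

Lemma smooth_derive1 (f : R -> R) : smooth f -> smooth (derive1 f).
Proof.
move=> sf; have -> : derive1 f = (fun s => 'D_1 f s).
  by apply/funext => s; rewrite derive1E.
exact: (smooth_derive (1 : R) sf).
Qed.

Lemma jsmooth_scale (f : R -> R) X : smooth f -> smooth X ->
  jsmooth (fun t => f t *: X).
Proof.
by move=> sf sX; apply: (@jsmoothZ _ _ f (fun=> X)) => //; exact: jsmooth_cst.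
Qed.

Lemma is_gflow_reparam (L : vfield R n) (g : R -> diffeo R n) (f : R -> R) :
  is_gflow (fun=> L) g -> smooth f -> f 0 = 0 ->
  is_gflow (fun t => derive1 f t *: L) (fun t => g (f t)).
Proof.
move=> [sg si g0 gE] sf f0; split.
- apply: (@smooth_comp _ _ _ _ _ (fun p : R * 'rV[R]_n => g p.1 p.2)) => //.
    exact: smooth_comp_fst.
  exact: smooth_snd.
- apply: (@smooth_comp _ _ _ _ _ (fun p : R * 'rV[R]_n => dinv (g p.1) p.2)) => //.
    exact: smooth_comp_fst.
  exact: smooth_snd.
- by rewrite f0.
- move=> t x.
  have dg : differentiable (fun s => g s x) (f t).
    exact: (@jsmooth_differentiable1 _ _ (fun s => dmap (g s))).
  have E := derive_comp (1 : R) (smooth_differentiable t sf) dg.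
  rewrite derive1E [LHS]E -derive1E -[X in 'D_X _ _]mulr1.
  have -> := deriveDirZ (1 : R) (derive1 f t) dg.
  by rewrite -derive1E gE.
Qed.

(** [first_integral] tests [phi] at every point of T^2 V, whereas invariance of F only speaks of
    jets of curves; this lemma bridges the gap. *)
Lemma jet2_surjective V (tbar : R -> R) (t : R) (p : triple R n) :
  fd_subspace V -> (forall X, V X -> smooth X) -> is_parameter tbar -> T2 V p ->
  exists2 X, tdep V X & jet2 tbar X t = p.
Proof.
move=> fV sV htbar [V0 V1 V2].
have [s0 s1 s2] : [/\ smooth p.1.1, smooth p.1.2 & smooth p.2] by split; exact: sV.
pose a := dt_dtbar tbar t; pose b := d2t_dtbar2 tbar t.
have a0 : a != 0 by exact: dt_dtbar_neq0.
(* For the curve p.1.1 + (s - t) Y + (s - t)^2 Z, the formula of [jet2E] requires a Y = p.1.2 and b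
   Y + 2 a^2 Z = p.2. *)
pose Y := a^-1 *: p.1.2.
pose Z := (2^-1 * a ^- 2) *: (p.2 - b *: Y).
have VY : V Y by exact: fd_subspaceZ.
have VZ : V Z.
  by apply: fd_subspaceZ => //; apply: fd_subspaceB => //; exact: fd_subspaceZ.
have [sY sZ] : smooth Y /\ smooth Z by split; exact: sV.
have sq c0 c1 c2 X : smooth X -> jsmooth (fun s => quartic t c0 c1 c2 0 0 s *: X).
  by move=> sX; apply: jsmooth_scale => //; exact: smooth_quartic.
have dq c0 c1 c2 X s : ddt (fun s => quartic t c0 c1 c2 0 0 s *: X) s =
    quartic t c1 (2 * c2) 0 0 0 s *: X.
  rewrite ddt_scale; last exact: smooth_quartic.
  by rewrite derive1_quartic !mulr0.
exists (fun s => quartic t 1 0 0 0 0 s *: p.1.1 + quartic t 0 1 0 0 0 s *: Y +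
                 quartic t 0 0 1 0 0 s *: Z).
  split; last by exact: (jsmoothD (jsmoothD (sq 1 0 0 _ s0) (sq 0 1 0 _ sY))
                                  (sq 0 0 1 _ sZ)).
  move=> s; apply: fd_subspaceD => //; last exact: fd_subspaceZ.
  by apply: fd_subspaceD => //; exact: fd_subspaceZ.
have D c0 c1 c2 d0 d1 d2 e0 e1 e2 :
    ddt (fun s => quartic t c0 c1 c2 0 0 s *: p.1.1 +
                  quartic t d0 d1 d2 0 0 s *: Y + quartic t e0 e1 e2 0 0 s *: Z) =
    (fun s => quartic t c1 (2 * c2) 0 0 0 s *: p.1.1 +
        quartic t d1 (2 * d2) 0 0 0 s *: Y + quartic t e1 (2 * e2) 0 0 0 s *: Z).
  apply/funext => s.
  have E := ddtD s (jsmoothD (sq c0 c1 c2 _ s0) (sq d0 d1 d2 _ sY)) (sq e0 e1 e2 _ sZ).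
  have E' := ddtD s (sq c0 c1 c2 _ s0) (sq d0 d1 d2 _ sY).
  by rewrite E' !dq in E; exact: E.
rewrite jet2E //; last first.
  by exact: (jsmoothD (jsmoothD (sq 1 0 0 _ s0) (sq 0 1 0 _ sY)) (sq 0 0 1 _ sZ)).
rewrite !D !quarticxx !mulr0 !scale0r !add0r !addr0 !scale1r !mulr1.
rewrite -/a -/b /Z scalerA divff// scale1r [2 *: _]scalerA [a ^+ 2 *: _]scalerA.
have -> : a ^+ 2 * (2 * (2^-1 * a ^- 2)) = 1 by field.
by rewrite scale1r addrC subrK -!surjective_pairing.
Qed.

End Curves.

(** * Invariants and first integrals *)

Section Invariants.
Variables (R : realType) (n : nat) (W V : set (vfield R n)) (tbar : R -> R)
  (F : (R -> vfield R n) -> R -> R) (phi : triple R n -> R).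
Hypothesis hS : quasi_lie_scheme W V.
Hypothesis htbar : is_parameter tbar.
Hypothesis hphi : smooth_on_T2 V phi.
Hypothesis hFphi : forall X t, tdep V X -> F X t = phi (jet2 tbar X t).

Let fW := qls_W_fd hS.
Let fV := qls_V_fd hS.
Let a := dt_dtbar tbar.
Let b := d2t_dtbar2 tbar.

Lemma triple_ext (p q : triple R n) :
  p.1.1 = q.1.1 -> p.1.2 = q.1.2 -> p.2 = q.2 -> p = q.
Proof. by case: p q => [[? ?] ?] [[? ?] ?] /= -> -> ->. Qed.

Lemma ddt_pushforward_cst (Y : R -> vfield R n) g X t : jsmooth Y ->
  is_gflow Y g -> smooth X ->
  ddt (fun s => pushforward (g s) X) t = - bracket (Y t) (pushforward (g t) X).
Proof.
move=> sY [sg si _ gE] sX.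
have E := @ddt_pushforward _ _ g (fun=> X) Y t sg si (jsmooth_cst sX) sY gE.
have E0 : ddt (fun=> X) t = 0 *: X.
  by apply/funext => x; rewrite /ddt derive1_cst scale0r.
by rewrite E0 pushforwardZ scale0r add0r in E.
Qed.

Lemma velocity_actJ2 (Y : R -> vfield R n) g p t : jsmooth Y ->
  is_gflow Y g -> T2 V p ->
  velocity (fun s => actJ2 (g s) p) t =
  (- bracket (Y t) (actJ2 (g t) p).1.1, - bracket (Y t) (actJ2 (g t) p).1.2,
   - bracket (Y t) (actJ2 (g t) p).2).
Proof.
move=> sY gf Vp; have [s0 s1 s2] := T2_smooth hS Vp.
congr (_, _, _).
- exact: ddt_pushforward_cst t sY gf s0.
- exact: ddt_pushforward_cst t sY gf s1.
- exact: ddt_pushforward_cst t sY gf s2.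
Qed.

Lemma T2_actJ2 (Y : R -> vfield R n) g p t : tdep W Y -> is_gflow Y g ->
  T2 V p -> T2 V (actJ2 (g t) p).
Proof.
move=> [WY sY] gf [V0 V1 V2].
have VP X := @pushforward_V _ _ W V hS Y g t X WY sY gf.
by split; exact: VP.
Qed.

Lemma pderivable_actJ2 (Y : R -> vfield R n) g p t : is_gflow Y g ->
  T2 V p -> pderivable (fun s => actJ2 (g s) p) t.
Proof.
move=> [sg si _ _] Vp x; have [s0 s1 s2] := T2_smooth hS Vp.
have d X : smooth X -> derivable (fun s => pushforward (g s) X x) t 1.
  move=> sX; apply: (@jsmooth_derivable1 _ _ (fun s => pushforward (g s) X)).
  exact: (jsmooth_pushforward sg si (jsmooth_cst sX)).
by split; exact: d.
Qed.

Lemma tdep_cst L : W L -> tdep W (fun=> L).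
Proof. by move=> WL; split => //; exact: jsmooth_cst (W_smooth hS WL). Qed.

Lemma actJ2_0 (Y : R -> vfield R n) g p : is_gflow Y g -> actJ2 (g 0) p = p.
Proof.
move=> [_ _ g0 _]; rewrite /actJ2 !(pushforward_id _ g0).
by case: p => [[]].
Qed.

Lemma phi_actJ2 (Y : R -> vfield R n) g p t :
  (forall A, fundJ2 W A -> first_integral V A phi) ->
  tdep W Y -> is_gflow Y g -> T2 V p -> phi (actJ2 (g t) p) = phi p.
Proof.
move=> HJ tY gf Vp; rewrite -[in RHS](actJ2_0 p gf).
apply: (constant_of_first_integral fV hphi (P := fun s => actJ2 (g s) p)) => s.
- exact: T2_actJ2 tY gf Vp.
- exact: pderivable_actJ2 gf Vp.
- have [WY sY] := tY.
  (* [h] is the one-parameter group of the field Y_s frozen at time [s], available by completeness.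
     At its time 0 it has the velocity of the generalised flow at time [s], namely minus the bracket
     with Y_s. *)
  have [h hf] := qls_complete hS (WY s).
  exists (generator (fun r => actJ2 (h r))); first by apply: HJ; exists (Y s), h.
  have Vs := T2_actJ2 s tY gf Vp.
  have [_ sYs] := tdep_cst (WY s).
  rewrite (velocity_actJ2 s sY gf Vp).
  rewrite [RHS](velocity_actJ2 0 sYs hf Vs).
  by rewrite (actJ2_0 _ hf).
Qed.

Lemma T2_jet2 X t : tdep V X -> T2 V (jet2 tbar X t).
Proof.
move=> tX; have [VX sX] := tX; rewrite jet2E//.
have tX1 := tdep_ddt fV tX; have [VX1 _] := tX1; have [VX2 _] := tdep_ddt fV tX1.
split => //=; first exact: fd_subspaceZ.
by apply: fd_subspaceD => //; exact: fd_subspaceZ.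
Qed.

Lemma invariant_of_first_integrals :
  (forall A, fundJ2 W A -> first_integral V A phi) ->
  (forall t0 A, fieldT1 W (a t0) (b t0) A -> first_integral V A phi) ->
  (forall t0 A, fundT2_0 W (a t0) A -> first_integral V A phi) ->
  forall g X, gflows W g -> tdep V X -> F (gflow_act g X) = F X.
Proof.
move=> HJ H1 H0 g X [Y tY gf] tX; apply/funext => t.
rewrite (hFphi t (tdep_gflow_act hS tY gf tX)) (hFphi t tX).
have [WY sY] := tY.
rewrite (jet2_gflow_act hS htbar t tY gf tX) -/(a t) -/(b t).
have WYt := WY t.
have tY1 := tdep_ddt fW tY; have [WY1 _] := tY1; have [WY2 _] := tdep_ddt fW tY1.
have Vp := T2_jet2 t tX; have Vg := T2_actJ2 t tY gf Vp.
have V1 := T2_flowT1 hS (a t) (b t) 1 WYt Vg.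
rewrite -(phi_actJ2 t HJ tY gf Vp).
set p := actJ2 _ _ in V1 Vg *.
have -> : phi p = phi (flowT1 (a t) (b t) (Y t) 1 p).
  apply/esym/(invariant_of_first_integral (Phi := flowT1 (a t) (b t) (Y t)) fV hphi).
  - by move=> s q Vq; exact: (T2_flowT1 hS).
  - by move=> s q Vq; exact: pderivable_quadratic (flowT1_quadratic _ _ _ q).
  - by move=> s q Vq; exact: (velocity_flowT1 hS).
  - by apply: (H1 t); exists (Y t).
  - exact: Vg.
  - by rewrite flowT1_quadratic expr0n /= !scale0r !addr0.
set p1 := flowT1 _ _ _ _ _ in V1 *; set q := (0, _, _).
(* The third entry contains the bracket of two elements of W, so this uses that W is a Lie
   algebra. *)
have Wq : T2_0 W q.
  split => //; split => /=.
  - exact: fd_subspace0.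
  - exact: fd_subspaceZ.
  - apply: fd_subspaceD => //.
      by apply: fd_subspaceD => //; exact: fd_subspaceZ.
    apply: fd_subspaceZ => //; apply: (qls_brWW hS) => //; exact: fd_subspaceZ.
rewrite -[q]scale1r.
have sq : smooth q.1.2 by apply: (W_smooth hS); case: Wq => -[].
have sX X' : V X' -> smooth X' by exact: (qls_smooth hS).
apply: (invariant_of_first_integral (Phi := fun s => actT2_0 (a t) (s *: q)) fV hphi).
- by move=> s r Vr; exact: (T2_actT2_0 hS).
- move=> s r [V0 _ _].
  exact: pderivable_quadratic (fun s => actT2_0_quadratic (a t) s sq (sX _ V0)).
- by move=> s r Vr; exact: (velocity_actT2_0 hS).
- by apply: (H0 t); exists q.
- exact: V1.
- have [V0 _ _] := V1.
  by rewrite (actT2_0_quadratic (a t) 0 sq (sX _ V0)) scale0r scaler0 !addr0.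
Qed.

(* Generalised flows exp(f(t) L) with f(0) = 0 have arbitrary third-order jets of
   f at t0, up to the constraint f(t0) = 0 when t0 = 0. *)
Lemma phi_gflow_step L g t0 s k0 k1 k2 p :
  (forall g X, gflows W g -> tdep V X -> F (gflow_act g X) = F X) ->
  W L -> is_gflow (fun=> L) g -> (t0 = 0 -> s = 0) -> T2 V p ->
  phi (actT2_0 (a t0) (0, k1 *: L, k2 *: L)
        (flowT1 (a t0) (b t0) (k0 *: L) 1 (actJ2 (g s) p))) = phi p.
Proof.
move=> inv WL gf t00 Vp; have a0 : a t0 != 0 by exact: dt_dtbar_neq0.
(* The values solve f' = k0, a f'' = k1 and b f'' + a^2 f''' = k2 at t0, so that the jet of f' L has
   the prescribed entries; f(t0) = s selects the group element. *)
have [f [sf f0 fs [f1 f2 f3]]] := hermite_interpolation k0 (k1 / a t0)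
  ((k2 - b t0 * (k1 / a t0)) / a t0 ^+ 2) t00.
have [X tX Xp] := jet2_surjective t0 fV (qls_smooth hS) htbar Vp.
have sL := W_smooth hS WL.
pose Y t := derive1 f t *: L.
have sf1 := smooth_derive1 sf; have sf2 := smooth_derive1 sf1.
have tY : tdep W Y.
  split; last exact: jsmooth_scale sf1 sL.
  by move=> t; exact: fd_subspaceZ.
have gYf := is_gflow_reparam gf sf f0.
have G : gflows W (fun t => g (f t)) by exists Y.
have := congr1 (fun h => h t0) (inv _ X G tX).
rewrite (hFphi t0 (tdep_gflow_act hS tY gYf tX)) (hFphi t0 tX).
have [_ sY] := tY.
rewrite (jet2_gflow_act hS htbar t0 tY gYf tX) -/(a t0) -/(b t0) Xp fs.
have dY t : ddt Y t = derive1 (derive1 f) t *: L by exact: ddt_scale.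
have ddY t : ddt (ddt Y) t = derive1 (derive1 (derive1 f)) t *: L.
  have -> : ddt Y = fun t => derive1 (derive1 f) t *: L by exact/funext.
  exact: ddt_scale.
rewrite dY ddY f2 f3 /Y f1.
(* All derivatives of Y are multiples of [L], so the correction a [Y', Y] in the parameter of T_2
   vanishes. *)
rewrite !scalerA (bracketZl _ sL (smoothZ_vf _ sL)) (bracketZr _ sL sL) bracketxx.
rewrite !scaler0 addr0 -scalerDl.
have e1 : a t0 * (k1 / a t0) = k1 by field.
have e2 : b t0 * (k1 / a t0) +
    a t0 ^+ 2 * ((k2 - b t0 * (k1 / a t0)) / a t0 ^+ 2) = k2 by field.
by rewrite e1 e2; exact.
Qed.

Lemma first_integrals_of_invariant :
  (forall g X, gflows W g -> tdep V X -> F (gflow_act g X) = F X) ->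
  [/\ (forall A, fundJ2 W A -> first_integral V A phi),
      (forall A, fundT2 W A -> first_integral V A phi),
      (forall t0 A, fieldT1 W (a t0) (b t0) A -> first_integral V A phi) &
      (forall t0 A, fundT2_0 W (a t0) A -> first_integral V A phi)].
Proof.
move=> inv.
(* With [s = 0] the group does not move the jet, and every base time is allowed, 0 included. *)
have step L t0 k0 k1 k2 p : W L -> T2 V p ->
    phi (actT2_0 (a t0) (0, k1 *: L, k2 *: L)
      (flowT1 (a t0) (b t0) (k0 *: L) 1 p)) = phi p.
  move=> WL Vp; have [g gf] := qls_complete hS WL.
  have := phi_gflow_step (t0 := t0) (s := 0) k0 k1 k2 inv WL gf (fun=> erefl) Vp.
  by rewrite (actJ2_0 _ gf).
have T0 x y p L : W L -> T2 V p -> flowT1 x y (0 *: L) 1 p = p.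
  move=> WL Vp; have [s0 s1 s2] := T2_smooth hS Vp; have sL := W_smooth hS WL.
  have sB := smooth_bracket sL s0.
  rewrite flowT1_quadratic (bracketZl 0 sL s0) (bracketZl 0 sL s1).
  rewrite (bracketZl 0 sL (smoothZ_vf 0 sB)).
  move: {s0 s1 s2 sB} (bracket L (0 *: bracket L p.1.1)) (bracket L p.1.1)
    (bracket L p.1.2) => B2 B1 BY; case: p Vp => [[X Y] Z] _.
  congr (_, _, _); apply: evP => xi; rewrite /= !(evD, evZ, evN, ev0);
    move: (ev xi) => e.
  * by move: (e X) => *; ring.
  * by move: (e Y) => *; ring.
  * by move: (e Z) => *; ring.
have regroup (p : triple R n) : (p.1.1, p.1.2, p.2) = p by case: p => [[]].
have A0 x M p : T2 V p -> actT2_0 x (0, 0, M) p = (p.1.1, p.1.2, p.2 + M).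
  move=> Vp; have [s0 s1 s2] := T2_smooth hS Vp.
  by rewrite /actT2_0 /= bracketC bracket0r// oppr0 scaler0 oppr0 !add0r.
have A00 x p : T2 V p -> actT2_0 x (0, 0, 0) p = p.
  by move=> Vp; rewrite (A0 x 0 p Vp) addr0; exact: regroup.
(* Translation of the third entry alone: this is the action T^2, and also the second half of T_2
   below. *)
have stepM L p k : W L -> T2 V p -> phi (p.1.1, p.1.2, p.2 + k *: L) = phi p.
  move=> WL Vp; have := step L 0 0 0 k p WL Vp.
  by rewrite T0// scale0r A0.
split.
- move=> A [L [g [WL gf ->]]].
  apply: (first_integral_of_invariant fV hphi) => [p _|s p Vp|p Vp|s p Vp].
  + exact: actJ2_0 gf.
  + exact: T2_actJ2 (tdep_cst WL) gf Vp.
  + exact: pderivable_actJ2 gf Vp.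
  (* At base time 1 the constraint on [s] is void, so every element of the one-parameter group is
     reached. *)
  + have t10 : (1 : R) = 0 -> s = 0 by move/eqP; rewrite oner_eq0.
    have := phi_gflow_step 0 0 0 inv WL gf t10 Vp.
    have Vg := T2_actJ2 s (tdep_cst WL) gf Vp.
    by rewrite T0// scale0r (A00 _ _ Vg).
- move=> A [q [[W0 W1 W2] q0 q1] ->].
  apply: (first_integral_of_invariant fV hphi) => [p _|s p Vp|p Vp|s p Vp].
  + by rewrite /actT2 scale0r addr0.
  + rewrite /actT2; apply: (T2D hS) => //; apply: (T2Z hS).
    by split; apply: (qls_WV hS).
  + exact: pderivable_quadratic (actT2_quadratic q p).
  + apply: etrans (stepM q.2 p s W2 Vp); congr phi.
    by rewrite /actT2; congr (_, _, _); rewrite /= ?q0 ?q1 scaler0 addr0.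
- move=> t0 A [L WL ->].
  apply: (first_integral_of_invariant fV hphi) => [p _|s p Vp|p Vp|s p Vp].
  + by rewrite flowT1_quadratic expr0n /= !scale0r !addr0.
  + exact: (T2_flowT1 hS).
  + exact: pderivable_quadratic (flowT1_quadratic _ _ _ p).
  + have [s0 s1 s2] := T2_smooth hS Vp; have sL := W_smooth hS WL.
    have sB := smooth_bracket sL s0.
    have VT := T2_flowT1 hS (a t0) (b t0) 1 (fd_subspaceZ s fW WL) Vp.
    have E := step L t0 s 0 0 p WL Vp.
    rewrite scale0r (A00 (a t0) _ VT) in E.
    (* [step] only gives time-one maps; time [s] for [L] is time one for [s *: L]. *)
    suff E1 : flowT1 (a t0) (b t0) L s p = flowT1 (a t0) (b t0) (s *: L) 1 p.
      by rewrite E1; exact: E.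
    clear E VT; rewrite !flowT1_quadratic (bracketZl s sL s0) (bracketZl s sL s1).
    rewrite (bracketZl s sL (smoothZ_vf s sB)) (bracketZr s sL sB).
    move: (bracket L (bracket L p.1.1)) (bracket L p.1.1) (bracket L p.1.2) => B2 B1 BY.
    apply: triple_ext; apply: evP => xi; rewrite /= !(evD, evZ, evN, ev0);
      move: (ev xi) => e.
    * by move: (e L) => *; ring.
    * by move: (e B1) => *; ring.
    * by move: (e B1) (e B2) (e BY) => *; ring.
- move=> t0 A [q Wq ->]; have [[W0 W1 W2] q0] := Wq.
  have sq := W_smooth hS W1.
  apply: (first_integral_of_invariant fV hphi) => [p Vp|s p Vp|p Vp|s p Vp].
  + have [s0 _ _] := T2_smooth hS Vp.
    by rewrite actT2_0_quadratic// scale0r scaler0 !addr0.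
  + exact: (T2_actT2_0 hS).
  + have [s0 _ _] := T2_smooth hS Vp.
    exact: pderivable_quadratic (fun s => actT2_0_quadratic (a t0) s sq s0).
  (* The two entries of [q] need not be multiples of one field, so [q] is split into a move by its
     second entry, realised by [step], followed by a translation of the third, realised by
     [stepM]. *)
  + have Wq1 : T2_0 W (0, q.1.2, 0).
      by split => //; split => //; exact: fd_subspace0.
    have Vq := T2_actT2_0 hS (a t0) s Wq1 Vp.
    have E := step q.1.2 t0 0 s 0 p W1 Vp; rewrite T0// in E.
    have Eq : (0, s *: q.1.2, 0 *: q.1.2) = s *: (0, q.1.2, 0) :> triple R n.
      by congr (_, _, _); rewrite ?scaler0 ?scale0r.
    rewrite Eq in E; apply: etrans E; apply: etrans (stepM q.2 _ s W2 Vq).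
    by congr phi; rewrite /actT2_0 /= scaler0 addr0.
Qed.

End Invariants.

Theorem theorem10p3 (R : realType) (n : nat) (W V : set (vfield R n))
    (tbar : R -> R) (F : (R -> vfield R n) -> R -> R)
    (phi : triple R n -> R)
    (hS : quasi_lie_scheme W V)
    (htbar : is_parameter tbar)
    (hF : forall X, tdep V X -> smooth (F X))
    (hphi : smooth_on_T2 V phi)
    (hFphi : forall X t, tdep V X -> F X t = phi (jet2 tbar X t)) :
  (quasi_lie_invariant W V F /\ order_two V tbar F) <->
  [/\ (forall A, fundJ2 W A -> first_integral V A phi),
      (forall A, fundT2 W A -> first_integral V A phi),
      (forall t0 A, fieldT1 W (dt_dtbar tbar t0) (d2t_dtbar2 tbar t0) A ->
         first_integral V A phi) &
      (forall t0 A, fundT2_0 W (dt_dtbar tbar t0) A ->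
         first_integral V A phi)].
Proof.
split=> [[[_ inv] _]|[HJ _ H1 H0]].
  exact: (first_integrals_of_invariant hS htbar hphi hFphi inv).
split; last by exists phi.
split=> //; exact: (invariant_of_first_integrals hS htbar hphi hFphi HJ H1 H0).
Qed.
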